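(* ($\mathsf{ZF}$) A set $A$ is strictly amorphous if and only if it is strongly amorphous.
   Context: The result is a theorem of $\mathsf{ZF}$, Zermelo--Fraenkel set theory without the axiom of choice. A set is finite if it is equinumerous with some natural number, and infinite otherwise. An amorphous set is an infinite set that cannot be partitioned into two infinite subsets. A strictly amorphous set is an amorphous set in which every partition has only finitely many non-singleton blocks. A strongly amorphous set is an infinite set $A$ such that, for every positive integer $k$, every $k$-ary relation $R\subseteq A^k$ is first-order definable from finitely many parameters in the language of equality, i.e. there are a first-order formula $\phi(x_1,\dots,x_k,y_1,\dots,y_n)$ whose only non-logical/relational symbol is equality and elements $e_1,\dots,e_n\in A$ such that $R=\{\langle a_1,\dots,a_k\rangle\in A^k\mid A\models\phi[a_1,\dots,a_k,e_1,\dots,e_n]\}$. *)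

(* Defs.v *)
(** Working in ZF is rendered as working inside an arbitrary model of ZF.
    Separation and Replacement are the first-order schemas: their second-order
    forms, in a metatheory with choice, would make every model satisfy the axiom
    of choice, so that no amorphous set would exist.  Apart from the instances of
    the two schemas, every definition below quantifies over elements of the
    model only; finiteness, natural numbers, first-order formulas over equality
    and their satisfaction are therefore the notions of the model (possibly
    nonstandard seen from outside), as they are in a theorem of ZF. *)

Set Implicit Arguments.
Unset Strict Implicit.

Record structure := Structure {
  carrier :> Type;
  mem : carrier -> carrier -> Prop
}.

Declare Scope zf_scope.
Delimit Scope zf_scope with zf.
Local Open Scope zf_scope.

Notation "x ∈ y" := (mem x y) (at level 70, no associativity) : zf_scope.
Notation "x ∉ y" := (~ mem x y) (at level 70, no associativity) : zf_scope.

(** The numbers in atomic formulas are de Bruijn indices. *)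

Inductive set_formula : Type :=
| SMem (i j : nat)
| SEq (i j : nat)
| SBot
| SImp (f g : set_formula)
| SAnd (f g : set_formula)
| SOr (f g : set_formula)
| SAll (f : set_formula)
| SEx (f : set_formula).

Definition scons (V : Type) (x : V) (env : nat -> V) (n : nat) : V :=
  match n with O => x | S n' => env n' end.

Fixpoint holds (V : structure) (env : nat -> V) (f : set_formula) : Prop :=
  match f with
  | SMem i j => env i ∈ env j
  | SEq i j => env i = env j
  | SBot => False
  | SImp f g => holds env f -> holds env g
  | SAnd f g => holds env f /\ holds env g
  | SOr f g => holds env f \/ holds env g
  | SAll f => forall x : V, holds (scons x env) f
  | SEx f => exists x : V, holds (scons x env) f
  end.

Definition subset (V : structure) (x y : V) : Prop :=
  forall z, z ∈ x -> z ∈ y.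

Definition is_empty (V : structure) (x : V) : Prop :=
  forall z, z ∉ x.

Definition is_upair (V : structure) (p x y : V) : Prop :=
  forall z, z ∈ p <-> z = x \/ z = y.

Definition is_singleton (V : structure) (p x : V) : Prop :=
  is_upair p x x.

(** Kuratowski pairs. *)
Definition is_pair (V : structure) (p x y : V) : Prop :=
  forall z, z ∈ p <-> is_singleton z x \/ is_upair z x y.

Definition is_union (V : structure) (u x y : V) : Prop :=
  forall z, z ∈ u <-> z ∈ x \/ z ∈ y.

Definition is_diff (V : structure) (d x y : V) : Prop :=
  forall z, z ∈ d <-> z ∈ x /\ z ∉ y.

(** [y] is the von Neumann successor of [x]. *)
Definition is_succ (V : structure) (y x : V) : Prop :=
  forall z, z ∈ y <-> z ∈ x \/ z = x.

Definition inductive_set (V : structure) (w : V) : Prop :=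
  (exists o, is_empty o /\ o ∈ w) /\
  (forall x, x ∈ w -> exists y, is_succ y x /\ y ∈ w).

Record ZF (V : structure) : Prop := {
  zf_extensionality :
    forall x y : V, (forall z, z ∈ x <-> z ∈ y) -> x = y;
  zf_foundation :
    forall x : V, ~ is_empty x ->
      exists y, y ∈ x /\ (forall z, z ∈ y -> z ∉ x);
  zf_pairing :
    forall x y : V, exists p, is_upair p x y;
  zf_union :
    forall x : V, exists u, forall z, z ∈ u <-> exists y, y ∈ x /\ z ∈ y;
  zf_powerset :
    forall x : V, exists p, forall z, z ∈ p <-> subset z x;
  zf_infinity :
    exists w : V, inductive_set w;
  zf_separation :
    forall (f : set_formula) (env : nat -> V) (a : V),
      exists b, forall x, x ∈ b <-> x ∈ a /\ holds (scons x env) f;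
  zf_replacement :
    forall (f : set_formula) (env : nat -> V) (a : V),
      (forall x y y', x ∈ a ->
         holds (scons x (scons y env)) f ->
         holds (scons x (scons y' env)) f -> y = y') ->
      exists b, forall y,
        y ∈ b <-> exists x, x ∈ a /\ holds (scons x (scons y env)) f
}.

Definition is_natural (V : structure) (n : V) : Prop :=
  forall w, inductive_set w -> n ∈ w.

Definition related (V : structure) (r x y : V) : Prop :=
  exists p, is_pair p x y /\ p ∈ r.

Definition is_function (V : structure) (f d c : V) : Prop :=
  (forall p, p ∈ f -> exists x y, x ∈ d /\ y ∈ c /\ is_pair p x y) /\
  (forall x, x ∈ d -> exists! y, related f x y).

Definition is_bijection (V : structure) (f d c : V) : Prop :=
  is_function f d c /\ (forall y, y ∈ c -> exists! x, related f x y).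

Definition equinumerous (V : structure) (x y : V) : Prop :=
  exists f, is_bijection f x y.

Definition finite (V : structure) (x : V) : Prop :=
  exists n, is_natural n /\ equinumerous x n.

Definition infinite (V : structure) (x : V) : Prop :=
  ~ finite x.

Definition amorphous (V : structure) (A : V) : Prop :=
  infinite A /\
  ~ (exists B C, is_union A B C /\ (forall x, x ∈ B -> x ∉ C) /\
       infinite B /\ infinite C).

Definition is_partition (V : structure) (P A : V) : Prop :=
  (forall b, b ∈ P -> ~ is_empty b /\ subset b A) /\
  (forall x, x ∈ A -> exists! b, b ∈ P /\ x ∈ b).

Definition strictly_amorphous (V : structure) (A : V) : Prop :=
  amorphous A /\
  (forall P, is_partition P A ->
     exists N, (forall b, b ∈ N <-> b ∈ P /\ ~ (exists x, is_singleton b x)) /\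
       finite N).

(** First-order formulas in the language of equality, inside the model.
    They are sets, built with numerical tags:
    (0,(i,j)) is x_i = x_j, (1,f) is ~ f, (2,(f,g)) is f /\ g, and (3,f) is an
    existential quantification.  Bound variables are de Bruijn levels: a formula
    is considered relative to a natural number m, its free variables being among
    x_0, ..., x_(m-1), and the quantifier in (3,f) then binds x_m, so that f is
    relative to m+1. *)

Fixpoint is_numeral (V : structure) (n : nat) (x : V) : Prop :=
  match n with
  | O => is_empty x
  | S n' => exists y, is_numeral n' y /\ is_succ x y
  end.

Definition is_tagged (V : structure) (n : nat) (c x : V) : Prop :=
  exists t, is_numeral n t /\ is_pair c t x.

Definition is_eq_code (V : structure) (c i j : V) : Prop :=
  exists p, is_pair p i j /\ is_tagged 0 c p.

Definition is_not_code (V : structure) (c f : V) : Prop :=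
  is_tagged 1 c f.

Definition is_and_code (V : structure) (c f g : V) : Prop :=
  exists p, is_pair p f g /\ is_tagged 2 c p.

Definition is_ex_code (V : structure) (c f : V) : Prop :=
  is_tagged 3 c f.

Record formula_closed (V : structure) (F : V) : Prop := {
  closed_eq : forall m i j c,
    is_natural m -> i ∈ m -> j ∈ m -> is_eq_code c i j -> related F m c;
  closed_not : forall m f c,
    is_natural m -> related F m f -> is_not_code c f -> related F m c;
  closed_and : forall m f g c,
    is_natural m -> related F m f -> related F m g -> is_and_code c f g ->
    related F m c;
  closed_ex : forall m m' f c,
    is_natural m -> is_succ m' m -> related F m' f -> is_ex_code c f ->
    related F m c
}.

(** [c] codes a formula with free variables among x_0, ..., x_(m-1). *)
Definition is_formula (V : structure) (m c : V) : Prop :=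
  forall F, formula_closed F -> related F m c.

(** The assignment [s], an element of A^m, determines [m]. *)
Record is_satisfaction (V : structure) (A S : V) : Prop := {
  sat_eq : forall m s i j c,
    is_natural m -> is_function s m A -> i ∈ m -> j ∈ m -> is_eq_code c i j ->
    (related S c s <-> exists x, related s i x /\ related s j x);
  sat_not : forall m s f c,
    is_natural m -> is_function s m A -> is_formula m f -> is_not_code c f ->
    (related S c s <-> ~ related S f s);
  sat_and : forall m s f g c,
    is_natural m -> is_function s m A -> is_formula m f -> is_formula m g ->
    is_and_code c f g ->
    (related S c s <-> related S f s /\ related S g s);
  sat_ex : forall m m' s f c,
    is_natural m -> is_function s m A -> is_succ m' m -> is_formula m' f ->
    is_ex_code c f ->
    (related S c s <->
     exists x s', x ∈ A /\
       (forall p, p ∈ s' <-> p ∈ s \/ is_pair p m x) /\ related S f s')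
}.

Definition satisfies (V : structure) (A f s : V) : Prop :=
  exists S, is_satisfaction A S /\ related S f s.

(** The formula has free variables x_0, ..., x_(k-1), x_k, ..., x_(m-1), where
    m = k + n; the n parameters are assigned by [e] to x_k, ..., x_(m-1). *)
Definition definable_with_parameters (V : structure) (A k R : V) : Prop :=
  exists m f d e,
    is_natural m /\ subset k m /\ is_formula m f /\
    is_diff d m k /\ is_function e d A /\
    (forall a, is_function a k A ->
       (a ∈ R <-> exists s, is_union s a e /\ satisfies A f s)).

Definition strongly_amorphous (V : structure) (A : V) : Prop :=
  infinite A /\
  (forall k R, is_natural k -> ~ is_empty k ->
     (forall a, a ∈ R -> is_function a k A) ->
     definable_with_parameters A k R).

(* Main.v *)
From Stdlib Require Import Classical ClassicalEpsilon Setoid Arith Lia.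
Require Import Defs.

(** The two notions meet in the notion of a finite support.  A finite set [E]
    contained in [A] supports a relation [R] on [A] when every transposition of
    two elements of [A] outside [E] preserves [R].

    An infinite set is strongly amorphous exactly when each of its relations has
    a finite support ([strongly_amorphous_iff]).  If [R] is definable in the
    language of equality, its parameters support it, because a transposition is
    an automorphism of [A] with equality ([satisfaction_invariant]).  Conversely,
    two tuples with the same equalities among their entries and with the elements
    of [E] are joined by a chain of transpositions outside [E], each correcting
    one entry ([supports_same_type]); so a supported relation is a union of
    equality types over [E], and there are finitely many of those, each given by
    a finite conjunction of equalities and inequalities ([supports_definable]).

    If all relations on [A] have finite supports, the support of a subset shows
    that it is finite or cofinite, and the support of the relation of lying in a
    common block shows that a partition has at most one non-singleton block
    avoiding the support ([supported_amorphous], [supported_partition]).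

    The remaining direction, [finite_support], is an induction on the arity.  Let
    [R] be a relation of arity [k + 1] on a strictly amorphous set [A], and [R_a]
    the [k]-ary relation obtained by fixing the last entry to [a].  By induction
    [R_a] has a finite support, and a least one, say [f a].  Now [f] sends
    elements of [A] to finite subsets of [A], and strict amorphousness makes such
    maps almost trivial: for some finite [E], [f a] is contained in [E] together
    with [a], for all [a] ([finite_values_almost_trivial]).  Hence [R_a] is a
    union of types over [E] and [a].  Such types, with [a] as a placeholder, form a
    finite set that does not depend on [a], so, [A] being amorphous, almost all [a]
    select the same types.
    The other [a], together with [E], support [R].

    For [finite_values_almost_trivial], close [f] under composition.  An
    amorphous set carries no strictly increasing sequence of subsets, for the
    elements entering at even steps and those entering at odd steps would split
    it ([amorphous_sequence_stops]); so the closure still has finite values, and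
    it becomes a preorder with finite initial segments.  For the same reason
    peeling off minimal elements stops after finitely many steps, and one layer
    is infinite.  On a layer the preorder is an equivalence relation with finite
    classes, almost all of which are singletons by strict amorphousness.

    All this takes place inside a model of ZF whose separation and replacement
    are first-order schemas, so each induction, separation and replacement comes
    with a proof that the predicate concerned is first-order definable with
    parameters; the tactic [def] supplies it. *)

Set Implicit Arguments.
Unset Strict Implicit.
Local Open Scope zf_scope.

(** * Definability with parameters *)

Section Definability.
Context {V : structure}.
Implicit Types (env : nat -> V) (P Q : (nat -> V) -> Prop) (t u v w : (nat -> V) -> V).

Definition shift env : nat -> V := fun n => env (S n).

(** Each index of a formula is read either as a variable or as a fixed element of
    the model, so that parameters need no place in the environment. *)
Definition decode (d : nat -> nat + V) env : nat -> V :=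
  fun n => match d n with inl i => env i | inr v => v end.

Definition definable P : Prop :=
  exists f d, forall env, holds (decode d env) f <-> P env.

(** A term is definable when its graph is; index [0] stands for the value. *)
Definition definable_term t : Prop :=
  definable (fun env => env 0 = t (fun n => env (S n))).

Definition up (r : nat -> nat) (n : nat) : nat :=
  match n with O => O | S n' => S (r n') end.

Fixpoint rename (r : nat -> nat) (f : set_formula) : set_formula :=
  match f with
  | SMem i j => SMem (r i) (r j)
  | SEq i j => SEq (r i) (r j)
  | SBot => SBot
  | SImp f g => SImp (rename r f) (rename r g)
  | SAnd f g => SAnd (rename r f) (rename r g)
  | SOr f g => SOr (rename r f) (rename r g)
  | SAll f => SAll (rename (up r) f)
  | SEx f => SEx (rename (up r) f)
  end.

Lemma holds_rename f : forall r env env',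
  (forall n, env' n = env (r n)) -> holds env (rename r f) <-> holds env' f.
Proof.
  assert (Hup : forall r env env' (x : V), (forall n, env' n = env (r n)) ->
    forall n, scons x env' n = scons x env (up r n)).
  { intros r env env' x H [|n]; simpl; auto. }
  induction f; intros r env env' H; simpl.
  - rewrite !H; tauto.
  - rewrite !H; tauto.
  - tauto.
  - rewrite (IHf1 _ _ _ H), (IHf2 _ _ _ H); tauto.
  - rewrite (IHf1 _ _ _ H), (IHf2 _ _ _ H); tauto.
  - rewrite (IHf1 _ _ _ H), (IHf2 _ _ _ H); tauto.
  - split; intros K x; specialize (K x); revert K; apply IHf; auto.
  - split; intros [x K]; exists x; revert K; apply IHf; auto.
Qed.

Lemma rename_id f : rename (fun n => n) f = f.
Proof.
  assert (H : forall f r, (forall n, r n = n) -> rename r f = f).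
  { clear f; induction f; intros r H; simpl; rewrite ?H, ?IHf1, ?IHf2; auto;
      rewrite IHf; auto; intros [|n]; simpl; auto. }
  auto.
Qed.

Lemma holds_ext f env env' :
  (forall n, env' n = env n) -> holds env f <-> holds env' f.
Proof. intros H. rewrite <- (rename_id f) at 1. now apply holds_rename. Qed.

Lemma definable_ext P Q :
  (forall env, Q env <-> P env) -> definable P -> definable Q.
Proof.
  intros H [f [d K]]. exists f, d. intros env. rewrite H. apply K.
Qed.

Lemma definable_rename (r : nat -> nat) P :
  definable P -> definable (fun env => P (fun n => env (r n))).
Proof.
  intros [f [d K]].
  exists f, (fun n => match d n with inl i => inl (r i) | inr v => inr v end).
  intros env. rewrite <- K. apply holds_ext. intros n. unfold decode.
  destruct (d n); auto.
Qed.

(** Interleaving two decodings lets two formulas share one. *)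
Lemma definable_common P Q : definable P -> definable Q ->
  exists f g d, (forall env, holds (decode d env) f <-> P env) /\
                (forall env, holds (decode d env) g <-> Q env).
Proof.
  intros [f [d K]] [g [e L]].
  set (m := fun n => if Nat.even n then d (Nat.div2 n) else e (Nat.div2 n)).
  exists (rename (fun n => 2 * n) f), (rename (fun n => S (2 * n)) g), m.
  split; intros env; [rewrite <- K | rewrite <- L]; apply holds_rename;
    intros n; unfold decode, m.
  - rewrite Nat.even_mul. simpl. replace (n + (n + 0)) with (2 * n) by lia.
    now rewrite Nat.div2_double.
  - rewrite Nat.even_succ, <- Nat.negb_even, Nat.even_mul. simpl orb.
    now rewrite Nat.div2_succ_double.
Qed.

Lemma definable_and P Q :
  definable P -> definable Q -> definable (fun env => P env /\ Q env).
Proof.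
  intros HP HQ. destruct (definable_common HP HQ) as (f & g & d & K & L).
  exists (SAnd f g), d. intros env. simpl. rewrite K, L. tauto.
Qed.

Lemma definable_or P Q :
  definable P -> definable Q -> definable (fun env => P env \/ Q env).
Proof.
  intros HP HQ. destruct (definable_common HP HQ) as (f & g & d & K & L).
  exists (SOr f g), d. intros env. simpl. rewrite K, L. tauto.
Qed.

Lemma definable_imp P Q :
  definable P -> definable Q -> definable (fun env => P env -> Q env).
Proof.
  intros HP HQ. destruct (definable_common HP HQ) as (f & g & d & K & L).
  exists (SImp f g), d. intros env. simpl. rewrite K, L. tauto.
Qed.

Lemma definable_const (p : Prop) : definable (fun _ => p).
Proof.
  destruct (classic p).
  - exists (SImp SBot SBot), (fun n => inl n). simpl. tauto.
  - exists SBot, (fun n => inl n). simpl. tauto.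
Qed.

Lemma definable_not P : definable P -> definable (fun env => ~ P env).
Proof. intros H. apply definable_imp; auto using definable_const. Qed.

Lemma definable_iff P Q :
  definable P -> definable Q -> definable (fun env => P env <-> Q env).
Proof. intros; apply definable_and; apply definable_imp; auto. Qed.

Lemma definable_quantified (Q : (nat -> V) -> V -> Prop) :
  definable (fun env => Q (fun n => env (S n)) (env 0)) ->
  exists f d, forall env x, holds (scons x (decode d env)) f <-> Q env x.
Proof.
  intros [f [d K]].
  exists (rename (fun n => match d n with inl O => O | _ => S n end) f),
    (fun n => match d n with inl (S i) => inl i | a => a end).
  intros env x. specialize (K (scons x env)). simpl in K.
  change (fun n => env n) with env in K. rewrite <- K.
  apply holds_rename. intros n. unfold decode.
  destruct (d n) as [[|i]|v] eqn:E; simpl; rewrite ?E; auto.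
Qed.

Lemma definable_ex (Q : (nat -> V) -> V -> Prop) :
  definable (fun env => Q (fun n => env (S n)) (env 0)) ->
  definable (fun env => exists x, Q env x).
Proof.
  intros H. destruct (definable_quantified H) as (f & d & K).
  exists (SEx f), d. intros env. simpl.
  split; intros [x L]; exists x; now apply K.
Qed.

Lemma definable_all (Q : (nat -> V) -> V -> Prop) :
  definable (fun env => Q (fun n => env (S n)) (env 0)) ->
  definable (fun env => forall x, Q env x).
Proof.
  intros H. destruct (definable_quantified H) as (f & d & K).
  exists (SAll f), d. intros env. simpl.
  split; intros L x; now apply K.
Qed.

Lemma definable_let t (Q : (nat -> V) -> V -> Prop) :
  definable_term t ->
  definable (fun env => Q (fun n => env (S n)) (env 0)) ->
  definable (fun env => Q env (t env)).
Proof.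
  intros Ht HQ.
  apply definable_ext with (fun env => exists x, x = t env /\ Q env x).
  - intros env. split; [eauto | intros (x & -> & H); auto].
  - apply definable_ex. apply definable_and; auto.
Qed.

Lemma definable_term_weaken t :
  definable_term t -> definable_term (fun env => t (fun n => env (S n))).
Proof.
  intros H. apply (definable_rename (up S) H).
Qed.

Lemma definable_term_var i : definable_term (fun env => env i).
Proof.
  exists (SEq 0 1), (fun n => match n with O => inl O | _ => inl (S i) end).
  intros env. simpl. tauto.
Qed.

Lemma definable_term_const (a : V) : definable_term (fun _ => a).
Proof.
  exists (SEq 0 1), (fun n => match n with O => inl O | _ => inr a end).
  intros env. simpl. tauto.
Qed.

End Definability.

Section Arities.
Context {V : structure}.

(** Registered predicates and operations; the tactic [def] looks up instances of
    these classes to pass under an application. *)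
Class Definable1 (P : V -> Prop) :=
  definable1 : definable (fun env => P (env 0)).
Class Definable2 (P : V -> V -> Prop) :=
  definable2 : definable (fun env => P (env 0) (env 1)).
Class Definable3 (P : V -> V -> V -> Prop) :=
  definable3 : definable (fun env => P (env 0) (env 1) (env 2)).
Class Definable4 (P : V -> V -> V -> V -> Prop) :=
  definable4 : definable (fun env => P (env 0) (env 1) (env 2) (env 3)).
Class Definable_term1 (F : V -> V) :=
  definable_term1 : definable_term (fun env => F (env 0)).
Class Definable_term2 (F : V -> V -> V) :=
  definable_term2 : definable_term (fun env => F (env 0) (env 1)).
Class Definable_term3 (F : V -> V -> V -> V) :=
  definable_term3 : definable_term (fun env => F (env 0) (env 1) (env 2)).
Implicit Types t u v w : (nat -> V) -> V.

Lemma definable_app1 P t :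
  Definable1 P -> definable_term t -> definable (fun env => P (t env)).
Proof.
  intros H Ht.
  apply (definable_let (Q := fun _ x => P x) Ht).
  exact H.
Qed.

Lemma definable_app2 P t u :
  Definable2 P -> definable_term t -> definable_term u ->
  definable (fun env => P (t env) (u env)).
Proof.
  intros H Ht Hu.
  apply (definable_let (Q := fun env x => P x (u env)) Ht).
  apply (definable_let (Q := fun env y => P (env 0) y)
           (definable_term_weaken Hu)).
  exact (definable_rename (fun n => match n with 0 => 1 | _ => 0 end) H).
Qed.

Lemma definable_app3 P t u v :
  Definable3 P -> definable_term t -> definable_term u -> definable_term v ->
  definable (fun env => P (t env) (u env) (v env)).
Proof.
  intros H Ht Hu Hv.
  apply (definable_let (Q := fun env x => P x (u env) (v env)) Ht).
  apply (definable_let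
    (Q := fun env y => P (env 0) y (v (fun n => env (S n))))
    (definable_term_weaken Hu)).
  apply (definable_let (Q := fun env z => P (env 1) (env 0) z)
    (definable_term_weaken (definable_term_weaken Hv))).
  exact (definable_rename
           (fun n => match n with 0 => 2 | 1 => 1 | _ => 0 end) H).
Qed.

Lemma definable_app4 P t u v w :
  Definable4 P -> definable_term t -> definable_term u -> definable_term v ->
  definable_term w -> definable (fun env => P (t env) (u env) (v env) (w env)).
Proof.
  intros H Ht Hu Hv Hw.
  apply (definable_let (Q := fun env x => P x (u env) (v env) (w env)) Ht).
  apply (definable_let
    (Q := fun env y => P (env 0) y (v (shift env)) (w (shift env)))
    (definable_term_weaken Hu)).
  apply (definable_let
    (Q := fun env z => P (env 1) (env 0) z (w (shift (shift env))))
    (definable_term_weaken (definable_term_weaken Hv))).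
  apply (definable_let (Q := fun env z => P (env 2) (env 1) (env 0) z)
    (definable_term_weaken (definable_term_weaken (definable_term_weaken Hw)))).
  exact (definable_rename
           (fun n => match n with 0 => 3 | 1 => 2 | 2 => 1 | _ => 0 end) H).
Qed.

Lemma definable_term_app1 F t :
  Definable_term1 F -> definable_term t -> definable_term (fun env => F (t env)).
Proof.
  intros H Ht. apply (definable_app2 (P := fun y x => y = F x)
    (t := fun env => env 0) (u := fun env => t (shift env))).
  - exact H.
  - apply definable_term_var.
  - now apply definable_term_weaken.
Qed.

Lemma definable_term_app2 F t u :
  Definable_term2 F -> definable_term t -> definable_term u ->
  definable_term (fun env => F (t env) (u env)).
Proof.
  intros H Ht Hu. apply (definable_app3 (P := fun y x x' => y = F x x')
    (t := fun env => env 0) (u := fun env => t (shift env))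
    (v := fun env => u (shift env))).
  - exact H.
  - apply definable_term_var.
  - now apply definable_term_weaken.
  - now apply definable_term_weaken.
Qed.

Lemma definable_term_app3 F t u v :
  Definable_term3 F -> definable_term t -> definable_term u ->
  definable_term v -> definable_term (fun env => F (t env) (u env) (v env)).
Proof.
  intros H Ht Hu Hv. apply (definable_app4 (P := fun y x x' x'' => y = F x x' x'')
    (t := fun env => env 0) (u := fun env => t (shift env))
    (v := fun env => u (shift env)) (w := fun env => v (shift env))).
  - exact H.
  - apply definable_term_var.
  - now apply definable_term_weaken.
  - now apply definable_term_weaken.
  - now apply definable_term_weaken.
Qed.

#[global] Instance definable_mem : Definable2 (@mem V).
Proof. exists (SMem 0 1), (fun n => inl n). intros env. simpl. tauto. Qed.

#[global] Instance definable_eq : Definable2 (@eq V).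
Proof. exists (SEq 0 1), (fun n => inl n). intros env. simpl. tauto. Qed.

End Arities.

Create HintDb definable.

(** Extended below to set-builders, once these exist. *)
Ltac def_binder := fail.

Ltac def_step :=
  cbv beta;
  match goal with
  | |- Definable1 _ => red
  | |- Definable2 _ => red
  | |- Definable3 _ => red
  | |- Definable4 _ => red
  | |- Definable_term1 _ => red
  | |- Definable_term2 _ => red
  | |- Definable_term3 _ => red
  | |- definable (fun _ => ?p) => apply (definable_const p)
  | |- definable (fun env => @?P env /\ @?Q env) =>
      apply (@definable_and _ P Q)
  | |- definable (fun env => @?P env \/ @?Q env) =>
      apply (@definable_or _ P Q)
  | |- definable (fun env => ~ @?P env) => apply (@definable_not _ P)
  | |- definable (fun env => @?P env <-> @?Q env) =>
      apply (@definable_iff _ P Q)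
  | |- definable (fun env => @?P env -> @?Q env) =>
      apply (@definable_imp _ P Q)
  | |- definable (fun env => exists x, @?Q env x) =>
      apply (@definable_ex _ Q)
  | |- definable (fun env => exists! x, @?Q env x) => unfold unique
  | |- definable (fun env => forall x, @?Q env x) =>
      apply (@definable_all _ Q)
  | |- definable_term (fun env => env ?i) => apply definable_term_var
  | |- definable_term (fun _ => ?a) => apply (definable_term_const a)
  | |- definable (fun env => ?P (@?t env)) =>
      apply (@definable_app1 _ P t); [solve [typeclasses eauto] | ]
  | |- definable (fun env => ?P (@?t env) (@?u env)) =>
      apply (@definable_app2 _ P t u); [solve [typeclasses eauto] | | ]
  | |- definable (fun env => ?P (@?t env) (@?u env) (@?v env)) =>
      apply (@definable_app3 _ P t u v); [solve [typeclasses eauto] | | | ]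
  | |- definable (fun env => ?P (@?t env) (@?u env) (@?v env) (@?w env)) =>
      apply (@definable_app4 _ P t u v w);
      [solve [typeclasses eauto] | | | | ]
  | |- definable_term (fun env => ?F (@?t env)) =>
      apply (@definable_term_app1 _ F t); [solve [typeclasses eauto] | ]
  | |- definable_term (fun env => ?F (@?t env) (@?u env)) =>
      apply (@definable_term_app2 _ F t u); [solve [typeclasses eauto] | | ]
  | |- definable_term (fun env => ?F (@?t env) (@?u env) (@?v env)) =>
      apply (@definable_term_app3 _ F t u v);
      [solve [typeclasses eauto] | | | ]
  | |- _ => def_binder
  | |- _ => progress autounfold with definable
  end.

Ltac def := intros; repeat def_step.

(** * Set-building operations *)

Existing Class ZF.

(** With these hints, the definability side condition of separation and
    replacement is discharged while rewriting. *)
#[global] Hint Extern 0 (Definable1 (fun _ => _)) => (solve [def]) : typeclass_instances.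
#[global] Hint Extern 0 (Definable_term1 (fun _ => _)) => (solve [def]) : typeclass_instances.

Section Comprehension.
Context {V : structure} {HZF : ZF V}.
Implicit Types (x y z a b c d f p : V) (φ : V -> Prop).

Lemma ext x y : (forall z, z ∈ x <-> z ∈ y) -> x = y.
Proof. apply (zf_extensionality HZF). Qed.

Lemma model_inhabited : inhabited V.
Proof. destruct (zf_infinity HZF) as [w _]. exact (inhabits w). Qed.

Lemma empty_exists : exists x : V, is_empty x.
Proof.
  destruct (zf_infinity HZF) as [w [[o [H _]] _]]. eauto.
Qed.

(** The set of all [z] with [φ z].  Proper classes are sent to the empty set, so
    that this operation is definable whether or not the set exists. *)
Definition comp φ : V :=
  epsilon model_inhabited (fun b =>
    (forall z, z ∈ b <-> φ z) \/
    ~ (exists b, forall z, z ∈ b <-> φ z) /\ is_empty b).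

Lemma comp_spec φ :
  (forall z, z ∈ comp φ <-> φ z) \/
  ~ (exists b, forall z, z ∈ b <-> φ z) /\ is_empty (comp φ).
Proof.
  unfold comp. apply epsilon_spec.
  destruct (classic (exists b, forall z, z ∈ b <-> φ z)) as [[b H]|H].
  - exists b. auto.
  - destruct empty_exists as [o Ho]. exists o. auto.
Qed.

Lemma in_comp φ :
  (exists b, forall z, z ∈ b <-> φ z) -> forall z, z ∈ comp φ <-> φ z.
Proof. intros H. destruct (comp_spec φ) as [K|[K _]]; tauto. Qed.

Lemma definable_comp (φ : (nat -> V) -> V -> Prop) :
  definable (fun env => φ (fun n => env (S n)) (env 0)) ->
  definable_term (fun env => comp (φ env)).
Proof.
  intros H. red.
  apply definable_ext with (fun env =>
    (forall z, z ∈ env 0 <-> φ (shift env) z) \/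
    ~ (exists b, forall z, z ∈ b <-> φ (shift env) z) /\
      (forall z, ~ z ∈ env 0)).
  - intros env. change (fun n => env (S n)) with (shift env). split.
    + intros ->. apply comp_spec.
    + intros K. apply ext. intros z.
      destruct (comp_spec (φ (shift env))) as [L|[L M]], K as [N|[N O]].
      * rewrite N, L. tauto.
      * exfalso; eauto.
      * exfalso; eauto.
      * split; intros J; exfalso; [eapply O | eapply M]; eauto.
  - assert (K : definable (fun env => φ (fun n => env (S (S n))) (env 0)))
      by exact (definable_rename (up S) H).
    assert (L : definable (fun env => φ (fun n => env (S (S (S n)))) (env 0)))
      by exact (definable_rename (up S) K).
    unfold shift.
    def; assumption.
Qed.

Definition ite (P : Prop) x y : V :=
  comp (fun z => P /\ z ∈ x \/ ~ P /\ z ∈ y).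

Lemma ite_true (P : Prop) x y : P -> ite P x y = x.
Proof.
  intros H. apply ext. intros z. unfold ite. rewrite in_comp.
  - tauto.
  - exists x. tauto.
Qed.

Lemma ite_false (P : Prop) x y : ~ P -> ite P x y = y.
Proof.
  intros H. apply ext. intros z. unfold ite. rewrite in_comp.
  - tauto.
  - exists y. tauto.
Qed.

Definition sep a φ : V := comp (fun z => z ∈ a /\ φ z).

Lemma separation a φ : Definable1 φ -> exists b, forall z, z ∈ b <-> z ∈ a /\ φ z.
Proof.
  intros [f [d H]].
  set (c := fun n => match d n with inr v => v | inl _ => a end).
  set (f' := rename (fun n => match d n with inl O => O | _ => S n end) f).
  destruct (zf_separation HZF f' c a) as [b Hb].
  exists b. intros z. rewrite Hb.
  enough (holds (scons z c) f' <-> φ z) by tauto.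
  rewrite <- (H (scons z (fun _ => a))).
  apply holds_rename. intros n. unfold decode, c.
  destruct (d n) as [[|i]|v] eqn:E; simpl; rewrite ?E; auto.
Qed.

Lemma in_sep {a φ} {H : Definable1 φ} z : z ∈ sep a φ <-> z ∈ a /\ φ z.
Proof. apply (@in_comp (fun z => z ∈ a /\ φ z)). now apply separation. Qed.

Definition image (F : V -> V) a : V := comp (fun y => exists x, x ∈ a /\ y = F x).

Lemma in_image {F a} {H : Definable_term1 F} y :
  y ∈ image F a <-> exists x, x ∈ a /\ y = F x.
Proof.
  apply in_comp. destruct H as [f [d H]].
  set (c := fun n => match d n with inr v => v | inl _ => a end).
  set (f' := rename (fun n => match d n with
    inl O => 1 | inl (S O) => 0 | _ => S (S n) end) f).
  assert (K : forall x y, holds (scons x (scons y c)) f' <-> y = F x).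
  { intros x y'. rewrite <- (H (scons y' (scons x (fun _ => a)))).
    apply holds_rename. intros n. unfold decode, c.
    destruct (d n) as [[|[|i]]|v] eqn:E; simpl; rewrite ?E; auto. }
  destruct (@zf_replacement V HZF f' c a) as [b Hb].
  - intros x y1 y2 _. rewrite !K. congruence.
  - exists b. intros z. rewrite Hb. split; intros (x & ? & L); exists x;
      (split; [auto|]); now apply K.
Qed.

Definition empt : V := comp (fun _ => False).

Lemma in_empt z : ~ z ∈ empt.
Proof.
  intros H. unfold empt in H. revert H. rewrite in_comp; [tauto|].
  destruct empty_exists as [o Ho]. exists o. intros w. split; [apply Ho | tauto].
Qed.

Lemma is_empty_eq x : is_empty x <-> x = empt.
Proof.
  split.
  - intros H. apply ext. intros z. split; intros K; exfalso; [eapply H | eapply in_empt]; eauto.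
  - intros ->. exact in_empt.
Qed.

Lemma nonempty_inhabited x : x <> empt -> exists z, z ∈ x.
Proof.
  intros H. apply NNPP. intros K. apply H, is_empty_eq. intros z Hz. eauto.
Qed.

Definition upair x y : V := comp (fun z => z = x \/ z = y).

Lemma in_upair x y z : z ∈ upair x y <-> z = x \/ z = y.
Proof. apply (@in_comp (fun z => z = x \/ z = y)), (zf_pairing HZF). Qed.

Definition sing x : V := upair x x.

Lemma in_sing x z : z ∈ sing x <-> z = x.
Proof. unfold sing. rewrite in_upair. tauto. Qed.

Definition pair x y : V := upair (sing x) (upair x y).

Lemma is_upair_eq p x y : is_upair p x y <-> p = upair x y.
Proof.
  split.
  - intros H. apply ext. intros z. rewrite in_upair. apply H.
  - intros -> z. apply in_upair.
Qed.

Lemma is_singleton_eq p x : is_singleton p x <-> p = sing x.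
Proof. apply is_upair_eq. Qed.

Lemma is_pair_eq p x y : is_pair p x y <-> p = pair x y.
Proof.
  unfold pair. rewrite <- is_upair_eq.
  split; intros H z; specialize (H z); revert H;
    rewrite is_singleton_eq, is_upair_eq; tauto.
Qed.

Lemma upair_inj x y y' : upair x y = upair x y' -> y = y'.
Proof.
  intros H.
  assert (K : y ∈ upair x y') by (rewrite <- H; apply in_upair; auto).
  assert (L : y' ∈ upair x y) by (rewrite H; apply in_upair; auto).
  rewrite in_upair in K, L. destruct K, L; congruence.
Qed.

Lemma pair_inj x y x' y' : pair x y = pair x' y' <-> x = x' /\ y = y'.
Proof.
  split; [|intros [-> ->]; auto].
  intros H. assert (Hx : x = x').
  { assert (K : sing x ∈ pair x' y') by (rewrite <- H; apply in_upair; auto).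
    apply in_upair in K.
    assert (L : x' ∈ sing x) by
      (destruct K as [K|K]; rewrite K; apply in_upair; auto).
    apply in_sing in L. auto. }
  subst x'. split; auto. unfold pair in H. apply upair_inj in H.
  now apply upair_inj in H.
Qed.

Definition union a : V := comp (fun z => exists y, y ∈ a /\ z ∈ y).

Lemma in_union a z : z ∈ union a <-> exists y, y ∈ a /\ z ∈ y.
Proof.
  apply (@in_comp (fun z => exists y, y ∈ a /\ z ∈ y)), (zf_union HZF).
Qed.

Definition cup a b : V := comp (fun z => z ∈ a \/ z ∈ b).

Lemma in_cup a b z : z ∈ cup a b <-> z ∈ a \/ z ∈ b.
Proof.
  apply (@in_comp (fun z => z ∈ a \/ z ∈ b)). exists (union (upair a b)).
  intros w. rewrite in_union. split.
  - intros (y & H & K). apply in_upair in H. destruct H; subst; auto.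
  - intros [H|H]; [exists a | exists b]; rewrite in_upair; auto.
Qed.

Definition adj a x : V := cup a (sing x).

Lemma in_adj a x z : z ∈ adj a x <-> z ∈ a \/ z = x.
Proof. unfold adj. rewrite in_cup, in_sing. tauto. Qed.

Definition cap a b : V := comp (fun z => z ∈ a /\ z ∈ b).

Lemma in_cap a b z : z ∈ cap a b <-> z ∈ a /\ z ∈ b.
Proof. apply (in_sep (φ := fun z => z ∈ b)). Qed.

Definition diff a b : V := comp (fun z => z ∈ a /\ ~ z ∈ b).

Lemma in_diff a b z : z ∈ diff a b <-> z ∈ a /\ ~ z ∈ b.
Proof. apply (in_sep (φ := fun z => ~ z ∈ b)). Qed.

Definition pow a : V := comp (fun z => subset z a).

Lemma in_pow a z : z ∈ pow a <-> subset z a.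
Proof. apply (@in_comp (fun z => subset z a)), (zf_powerset HZF). Qed.

Lemma is_union_eq u x y : is_union u x y <-> u = cup x y.
Proof.
  split.
  - intros H. apply ext. intros z. rewrite in_cup. apply H.
  - intros -> z. apply in_cup.
Qed.

Lemma is_diff_eq u x y : is_diff u x y <-> u = diff x y.
Proof.
  split.
  - intros H. apply ext. intros z. rewrite in_diff. apply H.
  - intros -> z. apply in_diff.
Qed.

Lemma subset_antisym x y : subset x y -> subset y x -> x = y.
Proof. intros H K. apply ext. intros z. split; auto. Qed.

End Comprehension.

Ltac def_binder ::=
  match goal with
  | |- definable_term (fun env => comp (@?φ env)) => apply (definable_comp (φ := φ))
  end.

#[global] Hint Unfold ite sep image : definable.

(* Keeps unification from comparing sets by comparing their defining predicates. *)
Opaque comp.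

Section SetTermDefinability.
Context {V : structure} {HZF : ZF V}.

#[global] Instance definable_subset : Definable2 (@subset V).
Proof. unfold subset. def. Qed.
#[global] Instance definable_is_singleton : Definable2 (@is_singleton V).
Proof. unfold is_singleton, is_upair. def. Qed.
#[global] Instance definable_upair : Definable_term2 (@upair V HZF).
Proof. unfold upair. def. Qed.
#[global] Instance definable_sing : Definable_term1 (@sing V HZF).
Proof. unfold sing. def. Qed.
#[global] Instance definable_pair : Definable_term2 (@pair V HZF).
Proof. unfold pair. def. Qed.
#[global] Instance definable_union : Definable_term1 (@union V HZF).
Proof. unfold union. def. Qed.
#[global] Instance definable_cup : Definable_term2 (@cup V HZF).
Proof. unfold cup. def. Qed.
#[global] Instance definable_adj : Definable_term2 (@adj V HZF).
Proof. unfold adj. def. Qed.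
#[global] Instance definable_cap : Definable_term2 (@cap V HZF).
Proof. unfold cap. def. Qed.
#[global] Instance definable_diff : Definable_term2 (@diff V HZF).
Proof. unfold diff. def. Qed.
#[global] Instance definable_pow : Definable_term1 (@pow V HZF).
Proof. unfold pow. def. Qed.

End SetTermDefinability.

(** * Functions *)

Section Functions.
Context {V : structure} {HZF : ZF V}.
Implicit Types (x y z a b c d e f g p r s : V) (F G : V -> V).

Lemma related_pair r x y : related r x y <-> pair x y ∈ r.
Proof.
  split.
  - intros (p & H & K). apply is_pair_eq in H. now subst.
  - intros H. exists (pair x y). now rewrite is_pair_eq.
Qed.

Definition prod a b : V :=
  sep (pow (pow (cup a b))) (fun p => exists x y, x ∈ a /\ y ∈ b /\ p = pair x y).

Lemma in_prod a b p :
  p ∈ prod a b <-> exists x y, x ∈ a /\ y ∈ b /\ p = pair x y.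
Proof.
  unfold prod. rewrite in_sep. split; [tauto|]. intros H. split; auto.
  destruct H as (x & y & Hx & Hy & ->). rewrite in_pow. intros q Hq.
  rewrite in_pow. intros z Hz. apply in_cup.
  apply in_upair in Hq. destruct Hq; subst q; apply in_upair in Hz;
    destruct Hz; subst; auto.
Qed.

Lemma pair_in_prod a b x y : pair x y ∈ prod a b <-> x ∈ a /\ y ∈ b.
Proof.
  rewrite in_prod. split.
  - intros (x' & y' & Hx & Hy & H). apply pair_inj in H.
    destruct H; subst; auto.
  - intros [Hx Hy]. exists x, y. auto.
Qed.

(** When [f] is a function, the union of the values related to [x] is the value
    at [x]. *)
Definition app f x : V := comp (fun z => exists y, pair x y ∈ f /\ z ∈ y).

#[global] Instance definable_app : Definable_term2 app.
Proof. unfold app. def. Qed.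
#[global] Instance definable_prod : Definable_term2 prod.
Proof. unfold prod. def. Qed.
#[global] Instance definable_related : Definable3 (@related V).
Proof. unfold related, is_pair, is_singleton, is_upair. def. Qed.
#[global] Instance definable_is_function : Definable3 (@is_function V).
Proof. unfold is_function, is_pair, is_singleton, is_upair. def. Qed.
#[global] Instance definable_is_bijection : Definable3 (@is_bijection V).
Proof. unfold is_bijection. def. Qed.

Lemma app_unique f x y :
  (forall y', pair x y' ∈ f <-> y' = y) -> app f x = y.
Proof.
  intros H. apply ext. intros z. unfold app. rewrite in_comp.
  - split.
    + intros (y' & K & L). apply H in K. now subst.
    + intros L. exists y. rewrite H. auto.
  - exists y. intros w. split.
    + intros L. exists y. rewrite H. auto.
    + intros (y' & K & L). apply H in K. now subst.
Qed.

Lemma function_pair f d c x y :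
  is_function f d c -> x ∈ d -> pair x y ∈ f <-> y = app f x.
Proof.
  intros [_ H] Hx. destruct (H x Hx) as (y0 & K & L).
  rewrite related_pair in K.
  assert (E : forall y', pair x y' ∈ f <-> y' = y0).
  { intros y'. rewrite <- related_pair. split.
    - intros M. symmetry. auto.
    - intros ->. now rewrite related_pair. }
  rewrite E, (app_unique E). tauto.
Qed.

Lemma function_related f d c x y :
  is_function f d c -> x ∈ d -> related f x y <-> y = app f x.
Proof. rewrite related_pair. apply function_pair. Qed.

Lemma function_mem f d c p :
  is_function f d c -> p ∈ f <-> exists x, x ∈ d /\ p = pair x (app f x).
Proof.
  intros H. split.
  - intros K. destruct (proj1 H p K) as (x & y & Hx & Hy & L).
    apply is_pair_eq in L. subst p. exists x. split; auto.
    apply pair_inj. split; auto. now apply (function_pair y H Hx).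
  - intros (x & Hx & ->). now apply (function_pair _ H Hx).
Qed.

Lemma function_pair_mem f d c x y :
  is_function f d c -> pair x y ∈ f <-> x ∈ d /\ y = app f x.
Proof.
  intros H. rewrite (function_mem _ H). split.
  - intros (x' & Hx & E). apply pair_inj in E. destruct E; subst; auto.
  - intros [Hx ->]. eauto.
Qed.

Lemma app_in f d c x : is_function f d c -> x ∈ d -> app f x ∈ c.
Proof.
  intros H Hx.
  assert (K : pair x (app f x) ∈ f) by now apply (function_pair _ H Hx).
  destruct (proj1 H _ K) as (x' & y & _ & Hy & L).
  apply is_pair_eq, pair_inj in L. destruct L as [_ ->]. auto.
Qed.

Lemma function_ext f g d c c' :
  is_function f d c -> is_function g d c' ->
  (forall x, x ∈ d -> app f x = app g x) -> f = g.
Proof.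
  intros Hf Hg H. apply ext. intros p.
  rewrite (function_mem _ Hf), (function_mem _ Hg).
  split; intros (x & Hx & ->); exists x; rewrite H; auto.
Qed.

Lemma function_intro f d c :
  (forall p, p ∈ f -> exists x y, x ∈ d /\ y ∈ c /\ p = pair x y) ->
  (forall x, x ∈ d -> exists y, forall y', pair x y' ∈ f <-> y' = y) ->
  is_function f d c.
Proof.
  intros H K. split.
  - intros p Hp. destruct (H p Hp) as (x & y & Hx & Hy & ->).
    exists x, y. rewrite is_pair_eq. auto.
  - intros x Hx. destruct (K x Hx) as [y Hy]. exists y. split.
    + now rewrite related_pair, Hy.
    + intros y' L. symmetry. now rewrite related_pair, Hy in L.
Qed.

Definition lam d F : V := image (fun x => pair x (F x)) d.

Lemma pair_in_lam d F x y : Definable_term1 F ->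
  pair x y ∈ lam d F <-> x ∈ d /\ y = F x.
Proof.
  intros HF. unfold lam. rewrite in_image. split.
  - intros (x' & Hx & E). apply pair_inj in E. destruct E; subst; auto.
  - intros [Hx ->]. eauto.
Qed.

Lemma lam_function d c F : Definable_term1 F ->
  (forall x, x ∈ d -> F x ∈ c) -> is_function (lam d F) d c.
Proof.
  intros HF H. apply function_intro.
  - intros p Hp. unfold lam in Hp. rewrite in_image in Hp.
    destruct Hp as (x & Hx & ->). exists x, (F x). auto.
  - intros x Hx. exists (F x). intros y'. rewrite pair_in_lam; tauto.
Qed.

Lemma app_lam d F x : Definable_term1 F -> x ∈ d -> app (lam d F) x = F x.
Proof.
  intros HF Hx. apply app_unique. intros y'. rewrite pair_in_lam; tauto.
Qed.

Definition funs d c : V := sep (pow (prod d c)) (fun f => is_function f d c).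

Lemma in_funs d c f : f ∈ funs d c <-> is_function f d c.
Proof.
  unfold funs. rewrite in_sep. split; [tauto|]. intros H. split; auto.
  rewrite in_pow. intros p Hp. rewrite (function_mem _ H) in Hp.
  destruct Hp as (x & Hx & ->). rewrite pair_in_prod. split; auto.
  eapply app_in; eauto.
Qed.

#[global] Instance definable_funs : Definable_term2 funs.
Proof. unfold funs. def. Qed.

Lemma function_empty c : is_function empt empt c.
Proof.
  apply function_intro; intros x Hx; destruct (in_empt Hx).
Qed.

Lemma function_domain_unique f d d' c c' :
  is_function f d c -> is_function f d' c' -> d = d'.
Proof.
  assert (K : forall f d d' c c', is_function f d c -> is_function f d' c' ->
     subset d d').
  { intros f' e e' b b' H H' x Hx.
    assert (L : pair x (app f' x) ∈ f') by now apply (function_pair _ H Hx).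
    rewrite (function_pair_mem _ _ H') in L. tauto. }
  intros H H'. apply subset_antisym; eauto.
Qed.

Lemma function_codomain f d c c' :
  is_function f d c -> (forall x, x ∈ d -> app f x ∈ c') -> is_function f d c'.
Proof.
  intros H K. apply function_intro.
  - intros p Hp. rewrite (function_mem _ H) in Hp. destruct Hp as (x & Hx & ->).
    exists x, (app f x). auto.
  - intros x Hx. exists (app f x). intros y'. now rewrite (function_pair _ H).
Qed.

Lemma function_cup f g d d' c :
  is_function f d c -> is_function g d' c -> (forall x, x ∈ d -> ~ x ∈ d') ->
  is_function (cup f g) (cup d d') c /\
  (forall x, x ∈ d -> app (cup f g) x = app f x) /\
  (forall x, x ∈ d' -> app (cup f g) x = app g x).
Proof.
  intros Hf Hg Hd.
  assert (K : forall x, x ∈ d ->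
    forall y', pair x y' ∈ cup f g <-> y' = app f x).
  { intros x Hx y'. specialize (Hd x Hx).
    rewrite in_cup, (function_pair_mem _ _ Hf), (function_pair_mem _ _ Hg).
    tauto. }
  assert (L : forall x, x ∈ d' ->
    forall y', pair x y' ∈ cup f g <-> y' = app g x).
  { intros x Hx y'. specialize (Hd x).
    rewrite in_cup, (function_pair_mem _ _ Hf), (function_pair_mem _ _ Hg).
    tauto. }
  split; [|split].
  - apply function_intro.
    + intros p Hp. rewrite in_cup, (function_mem _ Hf), (function_mem _ Hg) in Hp.
      destruct Hp as [(x & Hx & ->)|(x & Hx & ->)];
        [exists x, (app f x) | exists x, (app g x)]; rewrite in_cup;
        eauto using app_in.
    + intros x Hx. apply in_cup in Hx. destruct Hx; eauto.
  - intros x Hx. apply app_unique; auto.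
  - intros x Hx. apply app_unique; auto.
Qed.

Lemma function_single x y c : y ∈ c -> is_function (sing (pair x y)) (sing x) c.
Proof.
  intros Hy. apply function_intro.
  - intros p Hp. apply in_sing in Hp. exists x, y. rewrite in_sing. auto.
  - intros x' Hx. apply in_sing in Hx. subst x'. exists y. intros y'.
    rewrite in_sing, pair_inj. tauto.
Qed.

Lemma app_single x y : app (sing (pair x y)) x = y.
Proof. apply app_unique. intros y'. rewrite in_sing, pair_inj. tauto. Qed.

Definition snoc f x y : V := adj f (pair x y).

#[global] Instance definable_snoc : Definable_term3 snoc.
Proof. unfold snoc. def. Qed.

Lemma snoc_function f d c x y :
  is_function f d c -> y ∈ c -> ~ x ∈ d ->
  is_function (snoc f x y) (adj d x) c /\
  (forall z, z ∈ d -> app (snoc f x y) z = app f z) /\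
  app (snoc f x y) x = y.
Proof.
  intros Hf Hy Hx.
  destruct (@function_cup f (sing (pair x y)) d (sing x) c) as (H & K & L); auto.
  - now apply function_single.
  - intros z Hz E. apply in_sing in E. now subst.
  - split; [exact H|split; [exact K|]].
    unfold snoc, adj. rewrite L by now apply in_sing. apply app_single.
Qed.

Lemma snoc_restrict f d c x :
  is_function f (adj d x) c -> ~ x ∈ d ->
  is_function (lam d (app f)) d c /\
  f = snoc (lam d (app f)) x (app f x).
Proof.
  intros Hf Hx.
  assert (K : is_function (lam d (app f)) d c).
  { apply lam_function; [def|]. intros z Hz. eapply app_in; eauto.
    rewrite in_adj; auto. }
  split; auto.
  assert (Hfx : app f x ∈ c) by (eapply app_in; eauto; rewrite in_adj; auto).
  destruct (snoc_function K Hfx Hx) as (L & M & N).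
  apply (function_ext Hf L). intros z Hz. apply in_adj in Hz.
  destruct Hz as [Hz|Hz].
  - rewrite M by auto. rewrite app_lam; [auto|def|auto].
  - subst. now rewrite N.
Qed.

End Functions.

#[global] Hint Unfold lam : definable.

(** * Natural numbers and recursion *)

Section Naturals.
Context {V : structure} {HZF : ZF V}.
Implicit Types (x y z a b c d f g p r s k m n : V) (F G : V -> V).

Definition succ x : V := adj x x.

#[global] Instance definable_succ : Definable_term1 succ.
Proof. unfold succ. def. Qed.
#[global] Instance definable_is_natural : Definable1 (@is_natural V).
Proof. unfold is_natural, inductive_set, is_empty, is_succ. def. Qed.

Lemma in_succ x z : z ∈ succ x <-> z ∈ x \/ z = x.
Proof. apply in_adj. Qed.

Lemma is_succ_eq y x : is_succ y x <-> y = succ x.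
Proof.
  split.
  - intros H. apply ext. intros z. rewrite in_succ. apply H.
  - intros -> z. apply in_succ.
Qed.

Lemma mem_irrefl x : ~ x ∈ x.
Proof.
  intros H. destruct (zf_foundation HZF (x := sing x)) as (y & Hy & K).
  - intros E. apply (E x). now apply in_sing.
  - apply in_sing in Hy. subst y. apply (K x H). now apply in_sing.
Qed.

Lemma mem_asym x y : x ∈ y -> ~ y ∈ x.
Proof.
  intros H H'. destruct (zf_foundation HZF (x := upair x y)) as (z & Hz & K).
  - intros E. apply (E x). apply in_upair; auto.
  - apply in_upair in Hz. destruct Hz; subst z.
    + apply (K y H'). apply in_upair; auto.
    + apply (K x H). apply in_upair; auto.
Qed.

Lemma succ_inj x y : succ x = succ y -> x = y.
Proof.
  intros H.
  assert (K : x ∈ succ y) by (rewrite <- H; apply in_succ; auto).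
  assert (L : y ∈ succ x) by (rewrite H; apply in_succ; auto).
  apply in_succ in K, L. destruct K as [K|K], L as [L|L]; auto.
  destruct (mem_asym K L).
Qed.

Lemma succ_not_empty x : succ x <> empt.
Proof.
  intros H. apply (@in_empt V HZF x). rewrite <- H. apply in_succ; auto.
Qed.

Lemma natural_zero : is_natural (@empt V HZF).
Proof.
  intros w [(o & H & K) _]. apply is_empty_eq in H. now subst.
Qed.

Lemma natural_succ n : is_natural n -> is_natural (succ n).
Proof.
  intros H w Hw. destruct (proj2 Hw n (H w Hw)) as (y & K & L).
  apply is_succ_eq in K. now subst.
Qed.

Definition omega : V := comp (fun n => is_natural n).

Lemma in_omega n : n ∈ omega <-> is_natural n.
Proof.
  apply (@in_comp V HZF (fun n => is_natural n)).
  destruct (zf_infinity HZF) as [w Hw].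
  exists (sep w (fun n => is_natural n)). intros z. rewrite in_sep.
  split; [tauto|]. intros H. split; auto.
Qed.

Lemma natural_ind (P : V -> Prop) : Definable1 P ->
  P empt -> (forall n, is_natural n -> P n -> P (succ n)) ->
  forall n, is_natural n -> P n.
Proof.
  intros HP H0 HS n Hn.
  assert (K : n ∈ sep omega P).
  { apply Hn. split.
    - exists empt. rewrite is_empty_eq, in_sep, in_omega.
      auto using natural_zero.
    - intros x Hx. rewrite in_sep, in_omega in Hx. destruct Hx.
      exists (succ x). rewrite is_succ_eq, in_sep, in_omega.
      auto using natural_succ. }
  rewrite in_sep in K. tauto.
Qed.

Lemma natural_case n : is_natural n ->
  n = empt \/ exists m, is_natural m /\ n = succ m.
Proof.
  apply (natural_ind (P := fun n =>
    n = empt \/ exists m, is_natural m /\ n = succ m)); [def| |]; eauto.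
Qed.

Lemma natural_mem m n : is_natural n -> m ∈ n -> is_natural m.
Proof.
  intros Hn. revert m.
  apply (natural_ind (P := fun n => forall m, m ∈ n -> is_natural m)); auto; [def| |].
  - intros m Hm. destruct (in_empt Hm).
  - intros k Hk IH m Hm. apply in_succ in Hm. destruct Hm; subst; auto.
Qed.

Lemma natural_trans k m n : is_natural n -> k ∈ m -> m ∈ n -> k ∈ n.
Proof.
  intros Hn. revert k m.
  apply (natural_ind (P := fun n => forall k m, k ∈ m -> m ∈ n -> k ∈ n)); auto; [def| |].
  - intros k m _ Hm. destruct (in_empt Hm).
  - intros l Hl IH k m Hk Hm. apply in_succ. apply in_succ in Hm.
    destruct Hm; subst; eauto.
Qed.

Lemma zero_in_succ n : is_natural n -> empt ∈ succ n.
Proof.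
  apply (natural_ind (P := fun n => empt ∈ succ n)); [def| |].
  - apply in_succ; auto.
  - intros m Hm IH. apply in_succ; auto.
Qed.

Lemma succ_mem_succ m n : is_natural n -> m ∈ n -> succ m ∈ succ n.
Proof.
  intros Hn. revert m.
  apply (natural_ind (P := fun n => forall m, m ∈ n -> succ m ∈ succ n)); auto; [def| |].
  - intros m Hm. destruct (in_empt Hm).
  - intros k Hk IH m Hm. apply in_succ. apply in_succ in Hm.
    destruct Hm; subst; auto.
Qed.

Lemma natural_total m n : is_natural m -> is_natural n -> m ∈ n \/ m = n \/ n ∈ m.
Proof.
  intros Hm Hn. revert m Hm.
  apply (natural_ind (P := fun n => forall m, is_natural m -> m ∈ n \/ m = n \/ n ∈ m));
    auto; [def| |].
  - intros m Hm. destruct (natural_case Hm) as [->|(k & Hk & ->)]; auto.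
    right; right. now apply zero_in_succ.
  - intros k Hk IH m Hm. destruct (IH m Hm) as [H|[H|H]].
    + left. apply in_succ; auto.
    + left. apply in_succ; auto.
    + apply (succ_mem_succ Hm) in H. apply in_succ in H. destruct H; auto.
Qed.

(** Recursion through derivations: a witness is any set of pairs closed under taking
    predecessors, so existence and uniqueness of the value are plain inductions on
    [n]. *)
Definition rec_rel G a n x : Prop :=
  exists g, pair n x ∈ g /\
    forall k y, pair k y ∈ g ->
      k = empt /\ y = a \/ exists m z, k = succ m /\ y = G z /\ pair m z ∈ g.

Definition rec G a n : V := comp (fun z => exists x, rec_rel G a n x /\ z ∈ x).

Lemma rec_rel_zero G a x : rec_rel G a empt x <-> x = a.
Proof.
  split.
  - intros (g & H & K). destruct (K _ _ H) as [[_ ?]|(m & z & E & _)]; auto.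
    symmetry in E. destruct (succ_not_empty E).
  - intros ->. exists (sing (pair empt a)). rewrite in_sing. split; auto.
    intros k y Hk. apply in_sing, pair_inj in Hk. auto.
Qed.

Lemma rec_rel_succ G a n x :
  rec_rel G a (succ n) x <-> exists y, rec_rel G a n y /\ x = G y.
Proof.
  split.
  - intros (g & H & K). destruct (K _ _ H) as [[E _]|(m & z & E & -> & L)].
    + destruct (succ_not_empty E).
    + apply succ_inj in E. subst m. exists z. split; auto. exists g; auto.
  - intros (y & (g & H & K) & ->). exists (adj g (pair (succ n) (G y))).
    rewrite in_adj. split; auto. intros k w Hk. apply in_adj in Hk.
    destruct Hk as [Hk|Hk].
    + destruct (K k w Hk) as [L|(m & z & -> & -> & L)]; auto.
      right. exists m, z. rewrite in_adj. auto.
    + apply pair_inj in Hk. destruct Hk as [-> ->]. right. exists n, y.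
      rewrite in_adj. auto.
Qed.

Lemma rec_rel_functional G a n : Definable_term1 G -> is_natural n ->
  exists x, forall y, rec_rel G a n y <-> y = x.
Proof.
  intros HG.
  apply (natural_ind (P := fun n => exists x, forall y, rec_rel G a n y <-> y = x)).
  - unfold rec_rel. def.
  - exists a. intros y. apply rec_rel_zero.
  - intros m Hm [x Hx]. exists (G x). intros y. rewrite rec_rel_succ. split.
    + intros (z & Hz & ->). apply Hx in Hz. now subst.
    + intros ->. exists x. now rewrite Hx.
Qed.

Lemma rec_unique G a n x :
  (forall y, rec_rel G a n y <-> y = x) -> rec G a n = x.
Proof.
  intros H. apply ext. intros z. unfold rec.
  assert (K : forall z, z ∈ x <-> exists y, rec_rel G a n y /\ z ∈ y).
  { intros w. split.
    - intros Hw. exists x. now rewrite H.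
    - intros (y & Hy & Hw). apply H in Hy. now subst. }
  rewrite in_comp; [now rewrite K | eauto].
Qed.

Lemma rec_zero G a : rec G a empt = a.
Proof. apply rec_unique. intros y. apply rec_rel_zero. Qed.

Lemma rec_succ G a n : Definable_term1 G -> is_natural n ->
  rec G a (succ n) = G (rec G a n).
Proof.
  intros HG Hn. destruct (rec_rel_functional a HG Hn) as [x Hx].
  rewrite (rec_unique Hx). apply rec_unique. intros y.
  rewrite rec_rel_succ. split.
  - intros (z & Hz & ->). apply Hx in Hz. now subst.
  - intros ->. exists x. now rewrite Hx.
Qed.

Lemma rec_chain G a m n :
  Definable_term1 G ->
  (forall n, is_natural n -> subset (rec G a n) (rec G a (succ n))) ->
  is_natural n -> m ∈ succ n -> subset (rec G a m) (rec G a n).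
Proof.
  intros HG HS Hn. revert m. apply (natural_ind (P := fun n =>
    forall m, m ∈ succ n -> subset (rec G a m) (rec G a n))); auto.
  - unfold rec, rec_rel. def.
  - intros m Hm. apply in_succ in Hm. destruct Hm as [Hm| ->].
    + destruct (in_empt Hm).
    + intros z Hz; auto.
  - clear n Hn. intros n Hn IH m Hm. apply in_succ in Hm.
    destruct Hm as [Hm| ->].
    + intros z Hz. apply (HS n Hn). now apply (IH m Hm).
    + intros z Hz; auto.
Qed.

End Naturals.

#[global] Hint Unfold rec rec_rel : definable.

(** * Finite sets *)

Section Finite.
Context {V : structure} {HZF : ZF V}.
Implicit Types (x y z a b c d e f g p r s k m n : V) (F G : V -> V).

#[global] Instance definable_finite : Definable1 (@finite V).
Proof. unfold finite, equinumerous. def. Qed.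

#[global] Instance definable_infinite : Definable1 (@infinite V).
Proof. unfold infinite. def. Qed.

Lemma bijection_intro f d c :
  is_function f d c ->
  (forall x x', x ∈ d -> x' ∈ d -> app f x = app f x' -> x = x') ->
  (forall y, y ∈ c -> exists x, x ∈ d /\ app f x = y) ->
  is_bijection f d c.
Proof.
  intros Hf Hinj Hsurj. split; auto. intros y Hy.
  destruct (Hsurj y Hy) as (x & Hx & E). exists x. split.
  - rewrite related_pair, (function_pair_mem _ _ Hf). auto.
  - intros x'. rewrite related_pair, (function_pair_mem _ _ Hf).
    intros [Hx' E']. apply Hinj; auto. congruence.
Qed.

Lemma bijection_elim f d c : is_bijection f d c ->
  is_function f d c /\
  (forall x x', x ∈ d -> x' ∈ d -> app f x = app f x' -> x = x') /\
  (forall y, y ∈ c -> exists x, x ∈ d /\ app f x = y).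
Proof.
  intros [Hf H]. split; [|split]; auto.
  - intros x x' Hx Hx' E. destruct (H (app f x)) as (z & _ & K).
    + eapply app_in; eauto.
    + transitivity z; [symmetry|]; apply K;
        rewrite related_pair, (function_pair_mem _ _ Hf); auto.
  - intros y Hy. destruct (H y Hy) as (x & K & _).
    rewrite related_pair, (function_pair_mem _ _ Hf) in K.
    destruct K. exists x. auto.
Qed.

Lemma finite_empt : finite (@empt V HZF).
Proof.
  exists empt. split; [apply natural_zero|]. exists empt.
  apply bijection_intro; [apply function_empty| |]; intros;
    exfalso; eapply in_empt; eauto.
Qed.

Lemma adj_mem a x : x ∈ a -> adj a x = a.
Proof.
  intros H. apply ext. intros z. rewrite in_adj. split; auto.
  intros [K| ->]; auto.
Qed.

Lemma finite_adj a x : finite a -> finite (adj a x).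
Proof.
  intros Ha. destruct (classic (x ∈ a)) as [Hx|Hx].
  { now rewrite adj_mem. }
  destruct Ha as (n & Hn & f & Hf). exists (succ n).
  split; [now apply natural_succ|]. exists (snoc f x n).
  apply bijection_elim in Hf. destruct Hf as (Hf & Hi & Hs).
  assert (Hf' : is_function f a (succ n)).
  { apply (function_codomain Hf). intros z Hz. apply in_succ. left.
    eapply app_in; eauto. }
  assert (Hn' : n ∈ succ n) by (apply in_succ; auto).
  destruct (snoc_function Hf' Hn' Hx) as (H1 & H2 & H3).
  assert (Hne : forall z, z ∈ a -> app f z <> n).
  { intros z Hz E. apply (@mem_irrefl V HZF n). rewrite <- E at 1.
    eapply app_in; eauto. }
  apply bijection_intro; auto.
  - intros z z' Hz Hz'. apply in_adj in Hz, Hz'.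
    destruct Hz as [Hz|Hz], Hz' as [Hz'|Hz']; subst; rewrite ?H3, ?H2 by auto; auto.
    + intros E. destruct (Hne z Hz E).
    + intros E. symmetry in E. destruct (Hne z' Hz' E).
  - intros y Hy. apply in_succ in Hy. destruct Hy as [Hy|Hy].
    + destruct (Hs y Hy) as (z & Hz & E). exists z.
      rewrite in_adj, H2; auto.
    + subst y. exists x. rewrite in_adj; auto.
Qed.

Lemma finite_ind (P : V -> Prop) : Definable1 P ->
  P empt ->
  (forall a x, finite a -> ~ x ∈ a -> P a -> P (adj a x)) ->
  forall a, finite a -> P a.
Proof.
  intros HP H0 HS a (n & Hn & f & Hf). revert a f Hf.
  apply (natural_ind (P := fun n => forall a f, is_bijection f a n -> P a)); auto;
    [def| |].
  - intros a f Hf. apply bijection_elim in Hf. destruct Hf as (Hf & _).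
    enough (a = empt) by congruence. apply is_empty_eq. intros x Hx.
    apply (in_empt (app_in Hf Hx)).
  - clear n Hn. intros n Hn IH a f Hf. apply bijection_elim in Hf.
    destruct Hf as (Hf & Hi & Hs).
    destruct (Hs n) as (x & Hx & E); [apply in_succ; auto|].
    assert (K : is_bijection (lam (diff a (sing x)) (app f)) (diff a (sing x)) n).
    { apply bijection_intro.
      - apply lam_function; [def|]. intros z Hz. rewrite in_diff, in_sing in Hz.
        destruct Hz as [Hz Hzx].
        assert (K := app_in Hf Hz). apply in_succ in K.
        destruct K as [K|K]; auto. destruct Hzx. apply Hi; congruence.
      - intros z z' Hz Hz'. rewrite !app_lam; try def; auto.
        rewrite in_diff in Hz, Hz'. apply Hi; tauto.
      - intros y Hy. destruct (Hs y) as (z & Hz & Ez); [apply in_succ; auto|].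
        exists z. assert (L : z ∈ diff a (sing x)).
        { rewrite in_diff, in_sing. split; auto. intros ->.
          apply (@mem_irrefl V HZF n). congruence. }
        split; auto. rewrite app_lam; auto; def. }
    replace a with (adj (diff a (sing x)) x).
    + apply HS.
      * exists n. split; auto. eexists; eauto.
      * rewrite in_diff, in_sing. tauto.
      * eapply IH; eauto.
    + apply ext. intros z. rewrite in_adj, in_diff, in_sing.
      destruct (classic (z = x)); subst; tauto.
Qed.

Lemma finite_subset a b : finite b -> subset a b -> finite a.
Proof.
  intros Hb. revert a.
  apply (finite_ind (P := fun b => forall a, subset a b -> finite a)); auto;
    [def| |].
  - intros a H. replace a with (@empt V HZF); [apply finite_empt|].
    symmetry. apply is_empty_eq. intros z Hz. apply (in_empt (H z Hz)).
  - clear b Hb. intros b x Hb Hx IH a H.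
    assert (K : finite (diff a (sing x))).
    { apply IH. intros z. rewrite in_diff, in_sing. intros [Hz Hzx].
      apply H, in_adj in Hz. tauto. }
    apply (finite_adj x) in K.
    destruct (classic (x ∈ a)).
    + replace a with (adj (diff a (sing x)) x); auto.
      apply ext. intros z. rewrite in_adj, in_diff, in_sing.
      destruct (classic (z = x)); subst; tauto.
    + apply IH. intros z Hz. specialize (H z Hz). apply in_adj in H.
      destruct H; auto. congruence.
Qed.

Lemma finite_sing x : finite (sing x).
Proof.
  replace (sing x) with (adj empt x); [apply finite_adj, finite_empt|].
  apply ext. intros z. rewrite in_adj, in_sing.
  split; [|auto]. intros [H|H]; auto. destruct (in_empt H).
Qed.

Lemma finite_cup a b : finite a -> finite b -> finite (cup a b).
Proof.
  intros Ha Hb.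
  apply (finite_ind (P := fun b => finite (cup a b))); auto; [def| |].
  - replace (cup a empt) with a; auto. apply ext. intros z. rewrite in_cup.
    split; auto. intros [H|H]; auto. destruct (in_empt H).
  - clear b Hb. intros b x Hb Hx IH.
    replace (cup a (adj b x)) with (adj (cup a b) x).
    + now apply finite_adj.
    + apply ext. intros z. rewrite in_adj, !in_cup, in_adj. tauto.
Qed.

Lemma finite_image F a : Definable_term1 F -> finite a -> finite (image F a).
Proof.
  intros HF. apply (finite_ind (P := fun a => finite (image F a))); [def| |].
  - replace (image F empt) with (@empt V HZF); [apply finite_empt|].
    symmetry. apply is_empty_eq. intros z. rewrite in_image.
    intros (x & Hx & _). destruct (in_empt Hx).
  - intros b x Hb Hx IH. replace (image F (adj b x)) with (adj (image F b) (F x)).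
    + now apply finite_adj.
    + apply ext. intros z. rewrite in_adj, !in_image. split.
      * intros [(y & Hy & E)|E]; [exists y | exists x]; rewrite in_adj; auto.
      * intros (y & Hy & E). apply in_adj in Hy. destruct Hy; [left; eauto|].
        subst; auto.
Qed.

Lemma finite_union a :
  finite a -> (forall x, x ∈ a -> finite x) -> finite (union a).
Proof.
  apply (finite_ind (P := fun a => (forall x, x ∈ a -> finite x) -> finite (union a)));
    [def| |].
  - intros _. replace (union empt) with (@empt V HZF); [apply finite_empt|].
    symmetry. apply is_empty_eq. intros z. rewrite in_union.
    intros (x & Hx & _). destruct (in_empt Hx).
  - intros b x Hb Hx IH K. replace (union (adj b x)) with (cup (union b) x).
    + apply finite_cup.
      * apply IH. intros y Hy. apply K, in_adj; auto.
      * apply K, in_adj; auto.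
    + apply ext. intros z. rewrite in_cup, !in_union. split.
      * intros [(y & Hy & E)|E]; [exists y | exists x]; rewrite in_adj; auto.
      * intros (y & Hy & E). apply in_adj in Hy. destruct Hy; [left; eauto|].
        subst; auto.
Qed.

Lemma finite_pow a : finite a -> finite (pow a).
Proof.
  apply (finite_ind (P := fun a => finite (pow a))); [def| |].
  - apply (@finite_subset _ (sing empt)); [apply finite_sing|].
    intros z Hz. apply in_pow in Hz. apply in_sing, is_empty_eq.
    intros w Hw. apply (in_empt (Hz w Hw)).
  - intros b x Hb Hx IH.
    apply (@finite_subset _ (cup (pow b) (image (fun y => adj y x) (pow b)))).
    + apply finite_cup; auto. apply finite_image; auto. def.
    + intros y Hy. rewrite in_pow in Hy. rewrite in_cup, in_image, in_pow.
      destruct (classic (x ∈ y)) as [K|K].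
      * right. exists (diff y (sing x)). rewrite in_pow. split.
        -- intros z. rewrite in_diff, in_sing. intros [Hz Hzx].
           apply Hy, in_adj in Hz. tauto.
        -- apply ext. intros z. rewrite in_adj, in_diff, in_sing.
           destruct (classic (z = x)); subst; tauto.
      * left. intros z Hz. assert (L := Hy z Hz). apply in_adj in L.
        destruct L; auto. congruence.
Qed.

Lemma finite_prod a b : finite a -> finite b -> finite (prod a b).
Proof.
  intros Ha Hb.
  apply (@finite_subset _ (union (image (fun x => image (fun y => pair x y) b) a))).
  - apply finite_union.
    + apply finite_image; auto. def.
    + intros z Hz. rewrite in_image in Hz. destruct Hz as (x & Hx & ->).
      apply finite_image; auto. def.
  - intros p Hp. apply in_prod in Hp. destruct Hp as (x & y & Hx & Hy & ->).
    rewrite in_union. exists (image (fun y => pair x y) b). rewrite !in_image.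
    split; [exists x | exists y]; auto.
Qed.

Lemma finite_natural n : is_natural n -> finite n.
Proof.
  apply (natural_ind (P := fun n => finite n)); [def|apply finite_empt|].
  intros m _ IH. now apply finite_adj.
Qed.

(** In the contrapositive: a map from an infinite set to a finite one
    has an infinite fibre. *)
Lemma finite_fibers F a b : Definable_term1 F ->
  finite b -> (forall x, x ∈ a -> F x ∈ b) ->
  (forall y, y ∈ b -> finite (sep a (fun x => F x = y))) -> finite a.
Proof.
  intros HF Hb Hab H.
  apply (@finite_subset _ (union (image (fun y => sep a (fun x => F x = y)) b))).
  - apply finite_union.
    + apply finite_image; auto. def.
    + intros z Hz. rewrite in_image in Hz. destruct Hz as (y & Hy & ->). auto.
  - intros x Hx. rewrite in_union. exists (sep a (fun x' => F x' = F x)).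
    rewrite in_image, in_sep. split; [exists (F x)|]; auto.
Qed.

End Finite.

(** * Amorphous sets *)

Section Amorphous.
Context {V : structure} {HZF : ZF V}.
Implicit Types (x y z a b c d e f g p r s k m n X Y E L A : V) (F G : V -> V).

Lemma amorphous_split A B : amorphous A -> subset B A ->
  finite B \/ finite (diff A B).
Proof.
  intros [_ H] HB. apply NNPP. intros K. apply H.
  exists B, (diff A B). split; [|split].
  - apply is_union_eq, ext. intros z. rewrite in_cup, in_diff.
    destruct (classic (z ∈ B)); split; auto; tauto.
  - intros x Hx. rewrite in_diff. tauto.
  - split; intros L; tauto.
Qed.

Lemma infinite_member A E : infinite A -> finite E -> exists x, x ∈ A /\ ~ x ∈ E.
Proof.
  intros HA HE. apply NNPP. intros K. apply HA. apply (finite_subset HE).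
  intros x Hx. apply NNPP. eauto.
Qed.

Section Sequence.
Context (A a : V) (G : V -> V) {HG : Definable_term1 G}
  (Ha : subset a A)
  (HGA : forall X, subset X A -> subset (G X) A)
  (HGX : forall X, subset X A -> subset X (G X)).

Lemma rec_bounded n : is_natural n -> subset (rec G a n) A.
Proof.
  apply (natural_ind (P := fun n => subset (rec G a n) A)).
  - def.
  - now rewrite rec_zero.
  - intros m Hm IH. rewrite rec_succ; auto.
Qed.

Lemma rec_step n : is_natural n -> subset (rec G a n) (rec G a (succ n)).
Proof. intros Hn. rewrite rec_succ; auto. apply HGX. now apply rec_bounded. Qed.

Lemma rec_monotone m n : is_natural n -> m ∈ succ n ->
  subset (rec G a m) (rec G a n).
Proof.
  apply rec_chain; auto. exact rec_step.
Qed.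

Lemma finite_in_rec X : finite X ->
  (forall x, x ∈ X -> exists n, is_natural n /\ x ∈ rec G a n) ->
  exists n, is_natural n /\ subset X (rec G a n).
Proof.
  apply (finite_ind (P := fun X =>
    (forall x, x ∈ X -> exists n, is_natural n /\ x ∈ rec G a n) ->
    exists n, is_natural n /\ subset X (rec G a n))).
  - def.
  - intros _. exists empt. split; [apply natural_zero|].
    intros z Hz. destruct (in_empt Hz).
  - intros Y x HY Hx IH H. destruct IH as (n & Hn & K).
    { intros y Hy. apply H, in_adj; auto. }
    destruct (H x) as (m & Hm & L); [apply in_adj; auto|].
    assert (Hcase : n ∈ succ m \/ m ∈ succ n).
    { rewrite !in_succ. destruct (natural_total Hn Hm) as [|[|]]; auto. }
    destruct Hcase as [M|M]; [exists m | exists n]; split; auto;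
      intros z Hz; apply in_adj in Hz; destruct Hz as [Hz| ->]; auto.
    + apply (rec_monotone Hm M). auto.
    + apply (rec_monotone Hn M). auto.
Qed.

Definition flip x : V := ite (x = empt) (sing empt) empt.

#[local] Instance definable_flip : Definable_term1 flip.
Proof. unfold flip. def. Qed.

Definition parity n : V := rec flip empt n.

#[local] Instance definable_parity : Definable_term1 parity.
Proof. unfold parity. def. Qed.

Lemma sing_not_empty x : sing x <> empt.
Proof.
  intros H. apply (@in_empt V HZF x). rewrite <- H. now apply in_sing.
Qed.

Lemma flip_empt : flip empt = sing empt.
Proof. now apply ite_true. Qed.

Lemma flip_sing : flip (sing empt) = empt.
Proof. apply ite_false, sing_not_empty. Qed.

Lemma parity_cases n : is_natural n ->
  parity n = empt /\ parity (succ n) = sing empt \/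
  parity n = sing empt /\ parity (succ n) = empt.
Proof.
  intros Hn.
  assert (HS : forall m, is_natural m -> parity (succ m) = flip (parity m)).
  { intros m Hm. apply rec_succ; auto. exact _. }
  rewrite HS by auto.
  enough (K : parity n = empt \/ parity n = sing empt).
  { destruct K as [-> | ->]; rewrite ?flip_empt, ?flip_sing; auto. }
  apply (natural_ind (P := fun n => parity n = empt \/ parity n = sing empt)); auto.
  - def.
  - left. apply rec_zero.
  - intros m Hm IH. rewrite HS by auto.
    destruct IH as [-> | ->]; rewrite ?flip_empt, ?flip_sing; auto.
Qed.

Definition entering b : V :=
  sep A (fun x => exists n, is_natural n /\ x ∈ rec G a (succ n) /\
                       ~ x ∈ rec G a n /\ parity n = b).

Lemma in_entering b x : x ∈ entering b <-> x ∈ A /\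
  exists n, is_natural n /\ x ∈ rec G a (succ n) /\
                       ~ x ∈ rec G a n /\ parity n = b.
Proof. unfold entering. now rewrite in_sep. Qed.

(** A finite set of entering elements is caught by some term of the sequence, but
    one of the next two steps has parity [b] and adds an element. *)
Lemma entering_infinite b : b = empt \/ b = sing empt ->
  (forall n, is_natural n -> G (rec G a n) <> rec G a n) ->
  infinite (entering b).
Proof.
  intros Hb H K.
  destruct (finite_in_rec K) as (m & Hm & L).
  { intros x Hx. apply in_entering in Hx. destruct Hx as (_ & n & Hn & Hx & _).
    exists (succ n). split; auto using natural_succ. }
  assert (M : exists n, is_natural n /\ parity n = b /\ m ∈ succ n).
  { assert (N := parity_cases Hm).
    destruct (classic (parity m = b)).
    - exists m. rewrite in_succ. auto.
    - exists (succ m). rewrite !in_succ. split; [now apply natural_succ|].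
      split; auto. destruct Hb as [->| ->]; tauto. }
  destruct M as (n & Hn & Hnb & Hmn).
  destruct (classic (subset (G (rec G a n)) (rec G a n))) as [N|N].
  - apply (H n Hn). apply subset_antisym; auto. apply HGX. now apply rec_bounded.
  - apply not_all_ex_not in N. destruct N as [x N].
    apply imply_to_and in N. destruct N as [N O].
    apply O. apply (rec_monotone Hn Hmn). apply L. apply in_entering.
    rewrite <- (rec_succ a HG Hn) in N. split.
    + apply (rec_bounded (natural_succ Hn)). auto.
    + exists n. auto.
Qed.

(** The elements entering an increasing sequence at an even step, and those
    entering at an odd step, cannot both be infinitely many. *)
Lemma amorphous_sequence_stops : amorphous A ->
  exists n, is_natural n /\ G (rec G a n) = rec G a n.
Proof.
  intros HA. apply NNPP. intros H.
  assert (K : forall n, is_natural n -> G (rec G a n) <> rec G a n).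
  { intros n Hn E. apply H. eauto. }
  destruct (@amorphous_split A (entering empt)) as [L|L]; auto.
  - intros x Hx. apply in_entering in Hx. tauto.
  - revert L. apply entering_infinite; auto.
  - apply (@entering_infinite (sing empt)); auto.
    apply (finite_subset L). intros x Hx. apply in_diff.
    apply in_entering in Hx. destruct Hx as (Hx & m & Hm & H1 & H2 & H3).
    split; auto. intros Hx'. apply in_entering in Hx'.
    destruct Hx' as (_ & n & Hn & H4 & H5 & H6).
    destruct (natural_total Hm Hn) as [M|[M|M]].
    + apply H5. apply (rec_monotone (m := succ m) Hn); auto.
      now apply succ_mem_succ.
    + subst m. rewrite H3 in H6. now apply sing_not_empty in H6.
    + apply H2. apply (rec_monotone (m := succ n) Hm); auto.
      now apply succ_mem_succ.
Qed.

End Sequence.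
End Amorphous.

(** ** Maps to finite subsets of a strictly amorphous set *)

Section Closure.
Context {V : structure} {HZF : ZF V}.
Implicit Types (x y z a b c d e g p r s k m n X Y E L A : V) (F G f cl : V -> V).

Section Minimal.
Context (A : V) (cl : V -> V) {Hcl : Definable_term1 cl}
  (cl_subset : forall a, a ∈ A -> subset (cl a) A)
  (cl_finite : forall a, a ∈ A -> finite (cl a))
  (cl_refl : forall a, a ∈ A -> a ∈ cl a)
  (cl_trans : forall a b, a ∈ A -> b ∈ cl a -> subset (cl b) (cl a)).

(** Reading [b ∈ cl a] as [b ≤ a], the map [cl] is a preorder with finite initial
    segments; these are the minimal elements of what [X] leaves. *)
Definition minimal_outside X : V :=
  sep A (fun a => ~ a ∈ X /\ forall b, b ∈ cl a -> ~ b ∈ X -> a ∈ cl b).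

Lemma in_minimal_outside X a : a ∈ minimal_outside X <->
  a ∈ A /\ ~ a ∈ X /\ forall b, b ∈ cl a -> ~ b ∈ X -> a ∈ cl b.
Proof. unfold minimal_outside. now rewrite in_sep. Qed.

#[local] Instance definable_minimal_outside : Definable_term1 minimal_outside.
Proof. unfold minimal_outside. def. Qed.

(** By induction on a finite set bounding the initial segment: if the element [x]
    last added to the bound lies in the segment and is not itself minimal, then
    something strictly below [x] has its segment within the smaller bound. *)
Lemma minimal_exists X a : a ∈ A -> ~ a ∈ X ->
  exists b, b ∈ minimal_outside X.
Proof.
  intros Ha HaX.
  enough (K : forall Y, finite Y -> forall a, a ∈ A -> ~ a ∈ X ->
    subset (diff (cl a) X) Y -> exists b, b ∈ minimal_outside X).
  { apply (K (cl a) (cl_finite Ha) a); auto.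
    intros z Hz. apply in_diff in Hz. tauto. }
  clear a Ha HaX.
  apply (finite_ind (P := fun Y => forall a, a ∈ A -> ~ a ∈ X ->
    subset (diff (cl a) X) Y -> exists b, b ∈ minimal_outside X)).
  - def.
  - intros a Ha HaX H. destruct (@in_empt _ _ a). apply H, in_diff. auto.
  - intros Y x HY Hx IH a Ha HaX H.
    destruct (classic (x ∈ diff (cl a) X)) as [K|K].
    + apply in_diff in K. destruct K as [K HxX].
      assert (HxA : x ∈ A) by (eapply cl_subset; eauto).
      destruct (classic (x ∈ minimal_outside X)) as [L|L]; [eauto|].
      rewrite in_minimal_outside in L.
      assert (M : exists b, b ∈ cl x /\ ~ b ∈ X /\ ~ x ∈ cl b).
      { apply NNPP. intros M. apply L. split; [|split]; auto.
        intros b Hb HbX. apply NNPP. intros N. apply M. eauto. }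
      destruct M as (b & Hb & HbX & Hxb).
      apply (IH b); auto.
      * eapply cl_subset; [|eauto]. auto.
      * intros z Hz. apply in_diff in Hz. destruct Hz as [Hz HzX].
        assert (N : z ∈ adj Y x).
        { apply H, in_diff. split; auto.
          apply (cl_trans Ha K). apply (cl_trans HxA Hb). auto. }
        apply in_adj in N. destruct N; subst; tauto.
    + apply (IH a); auto. intros z Hz. assert (N := H z Hz).
      apply in_adj in N. destruct N; subst; tauto.
Qed.

(** Peeling off minimal elements repeatedly exhausts [A] in finitely many steps,
    so one layer is infinite. *)
Lemma infinite_layer : amorphous A ->
  exists X, finite X /\ subset X A /\ infinite (minimal_outside X).
Proof.
  intros HA.
  set (G := fun X => cup X (minimal_outside X)).
  assert (HG : Definable_term1 G) by (unfold G; def).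
  assert (HGA : forall X, subset X A -> subset (G X) A).
  { intros X HX z Hz. apply in_cup in Hz. destruct Hz as [Hz|Hz]; auto.
    apply in_minimal_outside in Hz. tauto. }
  assert (HGX : forall X, subset X A -> subset X (G X)).
  { intros X HX z Hz. apply in_cup. auto. }
  assert (HE : subset (@empt V HZF) A) by (intros z Hz; destruct (in_empt Hz)).
  destruct (amorphous_sequence_stops HE HGA HGX HA) as (N & HN & EN).
  apply NNPP. intros K.
  assert (L : finite (rec G empt N)).
  { apply (natural_ind (P := fun n => finite (rec G empt n))); auto.
    - def.
    - rewrite rec_zero. apply finite_empt.
    - intros n Hn IH. rewrite rec_succ by auto. apply finite_cup; auto.
      apply NNPP. intros M. apply K. exists (rec G empt n).
      split; [|split]; auto. apply (rec_bounded HE HGA Hn). }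
  apply (proj1 HA). apply (finite_subset L). intros a Ha. apply NNPP.
  intros Hn. destruct (minimal_exists Ha Hn) as [b Hb].
  assert (M : b ∈ rec G empt N) by (rewrite <- EN; apply in_cup; auto).
  apply in_minimal_outside in Hb. tauto.
Qed.

(** The classes of the preorder on an infinite layer, together with the singletons
    off that layer, form a partition; the exceptional set collects the complement
    of the layer and the finitely many classes with several elements. *)
Lemma closure_almost_trivial : strictly_amorphous A ->
  exists E, finite E /\ subset E A /\
    forall a b, a ∈ A -> ~ a ∈ E -> b ∈ cl a -> b = a \/ b ∈ E.
Proof.
  intros [HA HS]. destruct (infinite_layer HA) as (X & HX & HXA & HL).
  set (L := minimal_outside X) in *.
  assert (HLA : subset L A).
  { intros a Ha. apply in_minimal_outside in Ha. tauto. }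
  set (bl := fun a => ite (a ∈ L) (cap (cl a) L) (sing a)).
  assert (Hbl : Definable_term1 bl) by (unfold bl; def).
  assert (bl_in : forall a, a ∈ L -> bl a = cap (cl a) L).
  { intros a Ha. now apply ite_true. }
  assert (bl_out : forall a, ~ a ∈ L -> bl a = sing a).
  { intros a Ha. now apply ite_false. }
  assert (bl_self : forall a, a ∈ A -> a ∈ bl a).
  { intros a Ha. destruct (classic (a ∈ L)).
    - rewrite bl_in by auto. apply in_cap; auto.
    - rewrite bl_out by auto. now apply in_sing. }
  (* Minimality makes the preorder symmetric on the layer. *)
  assert (bl_eq : forall a b, a ∈ A -> b ∈ bl a -> bl b = bl a).
  { intros a b Ha Hb. destruct (classic (a ∈ L)) as [HaL|HaL].
    - rewrite bl_in in Hb by auto. apply in_cap in Hb. destruct Hb as [Hb HbL].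
      rewrite !bl_in by auto.
      assert (Hab : a ∈ cl b).
      { apply in_minimal_outside in HaL, HbL. apply HaL; tauto. }
      apply ext. intros z. rewrite !in_cap. split; intros [Hz HzL]; split; auto.
      + apply (cl_trans Ha Hb); auto.
      + apply (cl_trans (HLA b HbL) Hab); auto.
    - rewrite bl_out in Hb by auto. apply in_sing in Hb. now subst. }
  assert (bl_sub : forall a, a ∈ A -> subset (bl a) A).
  { intros a Ha z Hz. destruct (classic (a ∈ L)).
    - rewrite bl_in in Hz by auto. apply in_cap in Hz. apply HLA; tauto.
    - rewrite bl_out in Hz by auto. apply in_sing in Hz. now subst. }
  assert (bl_fin : forall a, a ∈ A -> finite (bl a)).
  { intros a Ha. destruct (classic (a ∈ L)).
    - rewrite bl_in by auto. apply (finite_subset (cl_finite Ha)).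
      intros z Hz. apply in_cap in Hz. tauto.
    - rewrite bl_out by auto. apply finite_sing. }
  destruct (HS (image bl A)) as (N & HN & HNfin).
  { split.
    - intros b Hb. rewrite in_image in Hb. destruct Hb as (a & Ha & ->).
      split; auto. intros K. apply (K a). auto.
    - intros x Hx. exists (bl x). split.
      + rewrite in_image. eauto.
      + intros b [Hb Hxb]. rewrite in_image in Hb. destruct Hb as (a & Ha & ->).
        auto. }
  exists (cup (diff A L) (union N)). split; [|split].
  - apply finite_cup.
    + destruct (amorphous_split HA HLA) as [K|K]; [destruct (HL K)|exact K].
    + apply finite_union; auto. intros b Hb. apply HN in Hb.
      rewrite in_image in Hb. destruct Hb as [(a & Ha & ->) _]. auto.
  - intros z Hz. apply in_cup in Hz. destruct Hz as [Hz|Hz].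
    + apply in_diff in Hz. tauto.
    + apply in_union in Hz. destruct Hz as (b & Hb & Hz). apply HN in Hb.
      rewrite in_image in Hb. destruct Hb as [(a & Ha & ->) _].
      eapply bl_sub; eauto.
  - intros a b Ha HaE Hb. rewrite in_cup, in_diff in HaE.
    assert (HaL : a ∈ L) by (apply NNPP; tauto).
    destruct (classic (b ∈ L)) as [HbL|HbL].
    + left. assert (K : exists x, is_singleton (bl a) x).
      { apply NNPP. intros K. apply HaE. right. apply in_union.
        exists (bl a). split; auto. apply HN. rewrite in_image. split; eauto. }
      destruct K as [x K]. apply is_singleton_eq in K.
      assert (M1 : a ∈ sing x) by (rewrite <- K; auto).
      assert (M2 : b ∈ sing x).
      { rewrite <- K, bl_in by auto. apply in_cap; auto. }
      apply in_sing in M1, M2. congruence.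
    + right. apply in_cup. left. apply in_diff. split; auto.
      eapply cl_subset; eauto.
Qed.

End Minimal.

Section FiniteValues.
Context (A : V) (f : V -> V) {Hf : Definable_term1 f}
  (f_subset : forall a, a ∈ A -> subset (f a) A)
  (f_finite : forall a, a ∈ A -> finite (f a))
  (HA : strictly_amorphous A).

(** Iterating [f] from [a] gives an increasing sequence of finite sets, which stops
    because [A] is amorphous. *)
Lemma finite_closed_superset a : a ∈ A ->
  exists X, finite X /\ subset X A /\ a ∈ X /\ forall b, b ∈ X -> subset (f b) X.
Proof.
  intros Ha.
  set (G := fun X => cup X (union (image f (cap X A)))).
  assert (HG : Definable_term1 G) by (unfold G; def).
  assert (HGA : forall X, subset X A -> subset (G X) A).
  { intros X HX z Hz. apply in_cup in Hz. destruct Hz as [Hz|Hz]; auto.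
    apply in_union in Hz. destruct Hz as (y & Hy & Hz). rewrite in_image in Hy.
    destruct Hy as (x & Hx & ->). apply in_cap in Hx. apply (@f_subset x); tauto. }
  assert (HGX : forall X, subset X A -> subset X (G X)).
  { intros X HX z Hz. apply in_cup. auto. }
  assert (Hs : subset (sing a) A).
  { intros z Hz. apply in_sing in Hz. now subst. }
  destruct (amorphous_sequence_stops Hs HGA HGX (proj1 HA)) as (N & HN & EN).
  exists (rec G (sing a) N). split; [|split; [|split]].
  - apply (natural_ind (P := fun n => finite (rec G (sing a) n))); auto.
    + def.
    + rewrite rec_zero. apply finite_sing.
    + intros n Hn IH. rewrite rec_succ by auto. apply finite_cup; auto.
      apply finite_union.
      * apply finite_image; auto. apply (finite_subset IH).
        intros z Hz. apply in_cap in Hz. tauto.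
      * intros y Hy. rewrite in_image in Hy. destruct Hy as (x & Hx & ->).
        apply f_finite. apply in_cap in Hx. tauto.
  - now apply rec_bounded.
  - apply (rec_monotone Hs HGA HGX HN (zero_in_succ HN)). rewrite rec_zero.
    now apply in_sing.
  - intros b Hb z Hz. rewrite <- EN. apply in_cup. right. apply in_union.
    exists (f b). split; auto. rewrite in_image. exists b. split; auto.
    apply in_cap. split; auto. eapply rec_bounded; eauto.
Qed.

Definition closure a : V :=
  sep A (fun b => forall X, a ∈ X -> (forall c, c ∈ X -> subset (f c) X) -> b ∈ X).

Lemma in_closure a b : b ∈ closure a <->
  b ∈ A /\ forall X, a ∈ X -> (forall c, c ∈ X -> subset (f c) X) -> b ∈ X.
Proof. unfold closure. now rewrite in_sep. Qed.

#[local] Instance definable_closure : Definable_term1 closure.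
Proof. unfold closure. def. Qed.

(** Algebraic closure is trivial in a strictly amorphous set, up to a fixed finite
    set. *)
Lemma finite_values_almost_trivial :
  exists E, finite E /\ subset E A /\
    forall a b, a ∈ A -> b ∈ f a -> b = a \/ b ∈ E.
Proof.
  assert (f_closure : forall a, a ∈ A -> subset (f a) (closure a)).
  { intros a Ha b Hb. apply in_closure. split.
    - now apply (@f_subset a).
    - intros X HaX HX. now apply (HX a). }
  destruct (@closure_almost_trivial A closure _) as (E & HE & HEA & H); auto.
  - intros a Ha b Hb. apply in_closure in Hb. tauto.
  - intros a Ha. destruct (finite_closed_superset Ha) as (X & HX & _ & HaX & K).
    apply (finite_subset HX). intros b Hb. apply in_closure in Hb.
    destruct Hb as [_ Hb]. auto.
  - intros a Ha. apply in_closure. auto.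
  - intros a b Ha Hb c Hc. apply in_closure in Hb, Hc. apply in_closure.
    split; [tauto|]. intros X HaX HX. apply Hc; auto. apply Hb; auto.
  - exists (cup E (union (image f E))). split; [|split].
    + (* The finitely many exceptional [a] are absorbed with their values. *)
      apply finite_cup; auto. apply finite_union.
      * now apply finite_image.
      * intros y Hy. rewrite in_image in Hy. destruct Hy as (a & Ha & ->). auto.
    + intros z Hz. apply in_cup in Hz. destruct Hz as [Hz|Hz]; auto.
      apply in_union in Hz. destruct Hz as (y & Hy & Hz). rewrite in_image in Hy.
      destruct Hy as (a & Ha & ->). apply (@f_subset a); auto.
    + intros a b Ha Hb. rewrite in_cup, in_union.
      destruct (classic (a ∈ E)) as [K|K].
      * right. right. exists (f a). rewrite in_image. eauto.
      * destruct (H a b Ha K); auto. now apply f_closure.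
Qed.

End FiniteValues.
End Closure.

(** * Transpositions acting on tuples *)

Section Transpositions.
Context {V : structure} {HZF : ZF V}.
Implicit Types (x y z a b c d e g p r s t k m n i j X Y E L A R : V).

Definition transpose b c x : V := ite (x = b) c (ite (x = c) b x).

#[global] Instance definable_transpose : Definable_term3 transpose.
Proof. unfold transpose. def. Qed.

Lemma transpose_left b c : transpose b c b = c.
Proof. now apply ite_true. Qed.

Lemma transpose_right b c : transpose b c c = b.
Proof.
  unfold transpose. destruct (classic (c = b)).
  - now rewrite ite_true.
  - rewrite ite_false by auto. now apply ite_true.
Qed.

Lemma transpose_other b c x : x <> b -> x <> c -> transpose b c x = x.
Proof. intros H K. unfold transpose. now rewrite !ite_false. Qed.

Lemma transpose_cases b c x :
  x = b /\ transpose b c x = c \/ x = c /\ transpose b c x = b \/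
  x <> b /\ x <> c /\ transpose b c x = x.
Proof.
  destruct (classic (x = b)); [subst; rewrite transpose_left; auto|].
  destruct (classic (x = c)); [subst; rewrite transpose_right; auto|].
  rewrite transpose_other; auto.
Qed.

Lemma transpose_involutive b c x : transpose b c (transpose b c x) = x.
Proof.
  destruct (transpose_cases b c x) as [[-> ->]|[[-> ->]|(H & K & ->)]].
  - apply transpose_right.
  - apply transpose_left.
  - now apply transpose_other.
Qed.

Lemma transpose_inj b c x y : transpose b c x = transpose b c y <-> x = y.
Proof.
  split; [|congruence]. intros H.
  rewrite <- (transpose_involutive b c x), H. apply transpose_involutive.
Qed.

Lemma transpose_sym b c x : transpose b c x = transpose c b x.
Proof.
  destruct (transpose_cases b c x) as [[-> ->]|[[-> ->]|(H & K & ->)]].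
  - now rewrite transpose_right.
  - now rewrite transpose_left.
  - now rewrite transpose_other.
Qed.

Lemma transpose_id b x : transpose b b x = x.
Proof.
  destruct (transpose_cases b b x) as [[-> ->]|[[-> ->]|(H & K & ->)]]; auto.
Qed.

Lemma transpose_in A b c x : b ∈ A -> c ∈ A -> x ∈ A -> transpose b c x ∈ A.
Proof.
  intros Hb Hc Hx.
  destruct (transpose_cases b c x) as [[-> ->]|[[-> ->]|(H & K & ->)]]; auto.
Qed.

Definition act k b c s : V := lam k (fun i => transpose b c (app s i)).

Lemma app_act k b c s i : i ∈ k -> app (act k b c s) i = transpose b c (app s i).
Proof. intros H. unfold act. rewrite app_lam; auto; def. Qed.

Lemma act_function A k b c s : b ∈ A -> c ∈ A ->
  is_function s k A -> is_function (act k b c s) k A.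
Proof.
  intros Hb Hc Hs. apply lam_function; [def|]. intros i Hi.
  apply transpose_in; auto. eapply app_in; eauto.
Qed.

Lemma act_eq A k b c s t : b ∈ A -> c ∈ A ->
  is_function s k A -> is_function t k A ->
  (forall i, i ∈ k -> transpose b c (app s i) = app t i) -> act k b c s = t.
Proof.
  intros Hb Hc Hs Ht H. apply (function_ext (act_function Hb Hc Hs) Ht).
  intros i Hi. rewrite app_act; auto.
Qed.

Lemma act_involutive A k b c s : b ∈ A -> c ∈ A -> is_function s k A ->
  act k b c (act k b c s) = s.
Proof.
  intros Hb Hc Hs. eapply act_eq; eauto using act_function.
  intros i Hi. rewrite app_act by auto. apply transpose_involutive.
Qed.

Lemma act_sym A k b c s : b ∈ A -> c ∈ A -> is_function s k A ->
  act k b c s = act k c b s.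
Proof.
  intros Hb Hc Hs. eapply act_eq; eauto using act_function.
  intros i Hi. rewrite app_act by auto. apply transpose_sym.
Qed.

Lemma act_id A k b s : b ∈ A -> is_function s k A -> act k b b s = s.
Proof.
  intros Hb Hs. eapply act_eq; eauto. intros i Hi. apply transpose_id.
Qed.

(** The identity [(b c) = (b d) (d c) (b d)]. *)
Lemma act_conjugate A k b c d s : b ∈ A -> c ∈ A -> d ∈ A ->
  b <> c -> b <> d -> c <> d -> is_function s k A ->
  act k b d (act k d c (act k b d s)) = act k b c s.
Proof.
  intros Hb Hc Hd H1 H2 H3 Hs. eapply act_eq; eauto using act_function.
  intros i Hi. rewrite !app_act by auto. generalize (app s i). intros x.
  destruct (transpose_cases b c x) as [[-> ->]|[[-> ->]|(Hxb & Hxc & ->)]].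
  - rewrite !transpose_left. now apply transpose_other; apply not_eq_sym.
  - rewrite (@transpose_other b d c) by auto.
    now rewrite !transpose_right.
  - destruct (classic (x = d)) as [->|Hxd].
    + rewrite transpose_right. rewrite (@transpose_other d c b) by auto.
      apply transpose_left.
    + rewrite (@transpose_other b d x), (@transpose_other d c x) by auto.
      now apply transpose_other.
Qed.

Lemma act_snoc A k b c s x : b ∈ A -> c ∈ A -> is_function s k A -> x ∈ A ->
  ~ k ∈ k ->
  act (succ k) b c (snoc s k x) = snoc (act k b c s) k (transpose b c x).
Proof.
  intros Hb Hc Hs Hx Hk.
  destruct (snoc_function Hs Hx Hk) as (H1 & H2 & H3).
  destruct (snoc_function (act_function Hb Hc Hs) (transpose_in Hb Hc Hx) Hk)
    as (K1 & K2 & K3).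
  eapply act_eq; eauto. intros i Hi. apply in_succ in Hi.
  destruct Hi as [Hi| ->].
  - rewrite H2, K2, app_act; auto.
  - now rewrite H3, K3.
Qed.

(** Transpositions are enough to test invariance, since they carry any tuple to any
    other of the same type; see [supports_same_type]. *)
Definition supports A k E R : Prop :=
  forall b c s, b ∈ A -> c ∈ A -> ~ b ∈ E -> ~ c ∈ E ->
    is_function s k A -> s ∈ R -> act k b c s ∈ R.

Definition equalities k s : V :=
  sep (prod k k) (fun p => exists i j, p = pair i j /\ app s i = app s j).

#[global] Instance definable_equalities : Definable_term2 equalities.
Proof. unfold equalities. def. Qed.

Lemma pair_in_equalities k s i j :
  pair i j ∈ equalities k s <-> i ∈ k /\ j ∈ k /\ app s i = app s j.
Proof.
  unfold equalities. rewrite in_sep, pair_in_prod. split.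
  - intros ([Hi Hj] & i' & j' & H & K). apply pair_inj in H.
    destruct H; subst; auto.
  - intros (Hi & Hj & H). split; eauto.
Qed.

Lemma equalities_bounded k s : subset (equalities k s) (prod k k).
Proof. intros z Hz. unfold equalities in Hz. rewrite in_sep in Hz. tauto. Qed.

Lemma equalities_eq k s t : equalities k s = equalities k t <->
  forall i j, i ∈ k -> j ∈ k -> (app s i = app s j <-> app t i = app t j).
Proof.
  split.
  - intros H i j Hi Hj.
    assert (K := pair_in_equalities k s i j).
    rewrite H, pair_in_equalities in K. tauto.
  - intros H. apply ext. intros z. split; intros Hz;
      assert (K := equalities_bounded Hz); apply in_prod in K;
      destruct K as (i & j & Hi & Hj & ->); revert Hz;
      rewrite !pair_in_equalities, (H i j Hi Hj); tauto.
Qed.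

(** Equality of quantifier-free types over [E] in the language of equality. *)
Definition same_type k E s t : Prop :=
  (forall i j, i ∈ k -> j ∈ k -> (app s i = app s j <-> app t i = app t j)) /\
  (forall i e, i ∈ k -> e ∈ E -> (app s i = e <-> app t i = e)).

Lemma same_type_sym k E s t : same_type k E s t -> same_type k E t s.
Proof. intros [H K]. split; intros; symmetry; auto. Qed.

Lemma same_type_trans k E s t u :
  same_type k E s t -> same_type k E t u -> same_type k E s u.
Proof.
  intros [H K] [H' K']. split; intros.
  - rewrite H by auto. auto.
  - rewrite K by auto. auto.
Qed.

Lemma same_type_act k E b c s : ~ b ∈ E -> ~ c ∈ E ->
  same_type k E (act k b c s) s.
Proof.
  intros Hb Hc. split.
  - intros i j Hi Hj. rewrite !app_act by auto. apply transpose_inj.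
  - intros i e Hi He. rewrite app_act by auto.
    assert (e <> b /\ e <> c) as [H1 H2] by (split; intros ->; auto).
    rewrite <- (transpose_other H1 H2) at 1. apply transpose_inj.
Qed.

End Transpositions.

#[global] Hint Unfold act : definable.

Section Supports.
Context {V : structure} {HZF : ZF V}.
Implicit Types (x y z a b c d e g p r s t u k m n i j X Y E L A R : V).

#[global] Instance definable_supports : Definable4 supports.
Proof. unfold supports. def. Qed.
#[global] Instance definable_same_type : Definable4 same_type.
Proof. unfold same_type. def. Qed.

(** Walk from [s] to [t] by correcting one entry at a time, in the order of the
    indices.  If the entries at [j] are [b] and [c], neither is in [E], and the
    transposition of [b] and [c] moves no earlier entry: such an entry would make
    the types differ. *)
Lemma supports_same_type A k E R s t : is_natural k -> supports A k E R ->
  is_function s k A -> is_function t k A -> same_type k E s t ->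
  s ∈ R -> t ∈ R.
Proof.
  intros Hk HR Hs Ht Hst HsR.
  enough (K : forall n, is_natural n -> n ∈ succ k ->
    exists u, is_function u k A /\ u ∈ R /\ same_type k E u t /\
      forall i, i ∈ n -> app u i = app t i).
  { destruct (K k Hk) as (u & Hu & HuR & _ & E1); [apply in_succ; auto|].
    now rewrite <- (function_ext Hu Ht E1). }
  apply (natural_ind (P := fun n => n ∈ succ k ->
    exists u, is_function u k A /\ u ∈ R /\ same_type k E u t /\
      forall i, i ∈ n -> app u i = app t i)).
  - def.
  - intros _. exists s. repeat split; try apply Hst; auto.
    + apply Hs.
    + apply Hs.
    + intros i Hi. destruct (in_empt Hi).
  - intros j Hj IH Hjk.
    assert (Hjk' : j ∈ k).
    { apply in_succ in Hjk. assert (L : j ∈ succ j) by (apply in_succ; auto).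
      destruct Hjk as [M|M].
      - apply (natural_trans Hk L M).
      - now rewrite <- M. }
    destruct IH as (u & Hu & HuR & Hut & Huj); [apply in_succ; auto|].
    destruct (classic (app u j = app t j)) as [Ej|Ej].
    { exists u. repeat (split; auto). intros i Hi. apply in_succ in Hi.
      destruct Hi as [Hi| ->]; auto. }
    set (b := app u j) in *. set (c := app t j) in *.
    assert (Hb : b ∈ A) by (eapply app_in; eauto).
    assert (Hc : c ∈ A) by (eapply app_in; eauto).
    assert (HbE : ~ b ∈ E).
    { intros L. apply Ej. symmetry. now apply (proj2 Hut j b Hjk' L). }
    assert (HcE : ~ c ∈ E).
    { intros L. apply Ej. now apply (proj2 Hut j c Hjk' L). }
    exists (act k b c u). split; [|split; [|split]].
    + now apply act_function.
    + now apply HR.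
    + eapply same_type_trans; [|eauto]. now apply same_type_act.
    + intros i Hi. apply in_succ in Hi. destruct Hi as [Hi| ->].
      * assert (Hik : i ∈ k) by apply (natural_trans Hk Hi Hjk').
        rewrite app_act by auto. rewrite (Huj i Hi).
        apply transpose_other.
        -- intros L. apply Ej. rewrite <- L. apply (proj1 Hut i j Hik Hjk').
           rewrite (Huj i Hi). auto.
        -- intros L. apply Ej. rewrite <- L, <- (Huj i Hi). symmetry.
           now apply (proj1 Hut i j Hik Hjk').
      * rewrite app_act by auto. apply transpose_left.
Qed.

Lemma supports_weaken A k E E' R : subset E E' -> supports A k E R -> supports A k E' R.
Proof. intros H K b c s Hb Hc HbE HcE. apply K; auto. Qed.

(** ** Every relation on a strictly amorphous set has a finite support *)

Section Rows.
Context (A k R : V) (HA : strictly_amorphous A) (Hk : is_natural k)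
  (IH : forall X, exists E, finite E /\ subset E A /\ supports A k E X).

Definition row a : V := sep (funs k A) (fun s => snoc s k a ∈ R).

#[local] Instance definable_row : Definable_term1 row.
Proof. unfold row. def. Qed.

Lemma in_row a s : s ∈ row a <-> is_function s k A /\ snoc s k a ∈ R.
Proof. unfold row. rewrite in_sep, in_funs. tauto. Qed.

Definition swappable X b c : Prop :=
  forall s, is_function s k A -> s ∈ X -> act k b c s ∈ X.

#[local] Instance definable_swappable : Definable3 swappable.
Proof. unfold swappable. def. Qed.

(** The least support of a row, given explicitly so that it becomes a function of
    [a]: an element belongs to it if infinitely many of its exchanges alter the
    row. *)
Definition row_support a : V :=
  sep A (fun b => infinite (sep A (fun c => ~ swappable (row a) b c))).

#[local] Instance definable_row_support : Definable_term1 row_support.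
Proof. unfold row_support. def. Qed.

Lemma in_row_support a b : b ∈ row_support a <->
  b ∈ A /\ infinite (sep A (fun c => ~ swappable (row a) b c)).
Proof. unfold row_support. rewrite in_sep; tauto. Qed.

Lemma row_support_finite a : finite (row_support a).
Proof.
  destruct (IH (row a)) as (E & HE & HEA & H).
  apply (finite_subset HE). intros b Hb. apply in_row_support in Hb.
  destruct Hb as [Hb K]. apply NNPP. intros HbE. apply K.
  apply (finite_subset HE). intros c Hc. rewrite in_sep in Hc.
  destruct Hc as [Hc L]. apply NNPP. intros HcE. apply L.
  intros s Hs. now apply H.
Qed.

(** Two elements outside the set can both be exchanged with cofinitely many others,
    hence with a common third one, and so with each other. *)
Lemma row_support_supports a : supports A k (row_support a) (row a).
Proof.
  intros b c s Hb Hc HbE HcE Hs HsR.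
  destruct (classic (b = c)) as [->|Hbc].
  { now rewrite (act_id Hc Hs). }
  rewrite in_row_support in HbE, HcE.
  set (Nb := sep A (fun d => ~ swappable (row a) b d)) in *.
  set (Nc := sep A (fun d => ~ swappable (row a) c d)) in *.
  assert (Fb : finite Nb) by (apply NNPP; intros L; apply HbE; auto).
  assert (Fc : finite Nc) by (apply NNPP; intros L; apply HcE; auto).
  destruct (@infinite_member _ _ A (adj (adj (cup Nb Nc) b) c)) as (d & Hd & K).
  { apply HA. }
  { apply finite_adj, finite_adj, finite_cup; auto. }
  rewrite !in_adj, in_cup in K. unfold Nb, Nc in K. rewrite !in_sep in K.
  assert (Kb : swappable (row a) b d) by (apply NNPP; tauto).
  assert (Kc : swappable (row a) c d) by (apply NNPP; tauto).
  assert (d <> b /\ d <> c) as [Hdb Hdc] by tauto.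
  rewrite <- (@act_conjugate _ _ A k b c d) by auto.
  assert (L1 := act_function Hb Hd Hs).
  assert (L2 := act_function Hd Hc L1).
  apply Kb; auto. rewrite (act_sym Hd Hc L1). apply Kc; auto.
Qed.

(** The type of [s] over [E] and one further element [b], coded so that it can be
    compared with types over [E] and other elements. *)
Definition type_code E b s : V :=
  pair (equalities k s)
    (pair (sep k (fun i => app s i = b))
       (sep (prod k E) (fun p => exists i e, p = pair i e /\ app s i = e))).

#[local] Instance definable_type_code : Definable_term3 type_code.
Proof. unfold type_code. def. Qed.

Definition type_codes E : V :=
  prod (pow (prod k k)) (prod (pow k) (pow (prod k E))).

Lemma type_code_in E b s : type_code E b s ∈ type_codes E.
Proof.
  unfold type_code, type_codes. rewrite !pair_in_prod, !in_pow.
  split; [apply equalities_bounded|].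
  split; intros z Hz; rewrite in_sep in Hz; tauto.
Qed.

Lemma type_codes_finite E : finite E -> finite (type_codes E).
Proof.
  intros HE. assert (Fk := finite_natural Hk).
  apply finite_prod; [|apply finite_prod]; apply finite_pow; auto;
    now apply finite_prod.
Qed.

Lemma type_code_eq E b c s t : type_code E b s = type_code E c t <->
  same_type k E s t /\ (forall i, i ∈ k -> (app s i = b <-> app t i = c)).
Proof.
  unfold type_code. rewrite !pair_inj. split.
  - intros (H1 & H2 & H3). split; [split|].
    + now apply equalities_eq.
    + intros i e Hi He.
      assert (L : forall u, app u i = e <-> pair i e ∈
        sep (prod k E) (fun p => exists i e, p = pair i e /\ app u i = e)).
      { intros u. rewrite in_sep, pair_in_prod. split.
        - intros L. repeat split; auto. exists i, e; auto.
        - intros (_ & i' & e' & L & M). apply pair_inj in L.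
          destruct L; subst; auto. }
      rewrite !L, H3. tauto.
    + intros i Hi.
      assert (L : forall u b, app u i = b <-> i ∈ sep k (fun i => app u i = b)).
      { intros u b'. rewrite in_sep. tauto. }
      rewrite !L, H2. tauto.
  - intros [[H1 H3] H2]. split; [now apply equalities_eq|].
    split; apply ext; intros z; rewrite !in_sep.
    + split; intros [Hz L]; split; auto; revert L; apply H2; auto.
    + split; intros [Hz (i & e & -> & L)]; split; auto; exists i, e; split; auto;
        apply pair_in_prod in Hz; revert L; apply H3; tauto.
Qed.

Lemma same_type_adj E b s t : same_type k E s t ->
  (forall i, i ∈ k -> (app s i = b <-> app t i = b)) -> same_type k (adj E b) s t.
Proof.
  intros [H K] L. split; auto. intros i e Hi He. apply in_adj in He.
  destruct He as [He| ->]; auto.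
Qed.

(** When [b] and [c] select the same type codes, exchanging them maps the row of [b]
    into the row of [c]: the image of a tuple has the code of some tuple of the
    second row, and that row contains all tuples of the same type. *)
Lemma row_transfer E b c s :
  (forall a, a ∈ A -> supports A k (adj E a) (row a)) ->
  b ∈ A -> c ∈ A -> ~ b ∈ E -> ~ c ∈ E ->
  image (fun t => type_code E b t) (row b) = image (fun t => type_code E c t) (row c) ->
  s ∈ row b -> act k b c s ∈ row c.
Proof.
  intros HE Hb Hc HbE HcE H Hs.
  assert (Hs' := Hs). apply in_row in Hs'. destruct Hs' as [Hsf _].
  assert (K : type_code E b s ∈ image (fun t => type_code E c t) (row c)).
  { rewrite <- H, in_image. eauto. }
  rewrite in_image in K. destruct K as (t & Ht & K).
  assert (Ht' := Ht). apply in_row in Ht'. destruct Ht' as [Htf _].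
  apply type_code_eq in K. destruct K as [K L].
  apply (@supports_same_type A k (adj E c) (row c) t); auto.
  - now apply act_function.
  - apply same_type_adj.
    + apply same_type_trans with s; [now apply same_type_sym|].
      apply same_type_sym. now apply same_type_act.
    + intros i Hi. rewrite <- L by auto. rewrite app_act by auto.
      now rewrite <- (transpose_inj b c (app s i) b), transpose_left.
Qed.

(** The elements selecting one particular set of codes are cofinitely many; the
    rest is a support. *)
Lemma finite_support_step :
  exists E, finite E /\ subset E A /\ supports A (succ k) E R.
Proof.
  destruct (@finite_values_almost_trivial _ _ A row_support _) as (E & HE & HEA & H); auto.
  { intros a Ha b Hb. apply in_row_support in Hb. tauto. }
  { intros a Ha. apply row_support_finite. }
  assert (Hrow : forall a, a ∈ A -> supports A k (adj E a) (row a)).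
  { intros a Ha. apply (supports_weaken (E := row_support a)).
    - intros b Hb. apply in_adj. destruct (H a b Ha Hb); auto.
    - apply row_support_supports. }
  assert (HAE : infinite (diff A E)).
  { intros K. apply (proj1 (proj1 HA)).
    apply (finite_subset (finite_cup K HE)). intros z Hz.
    rewrite in_cup, in_diff. destruct (classic (z ∈ E)); auto. }
  set (h := fun b => image (fun t => type_code E b t) (row b)).
  assert (Hh : Definable_term1 h) by (unfold h; def).
  assert (HK : exists y, infinite (sep (diff A E) (fun b => h b = y))).
  { apply NNPP. intros K. apply HAE.
    apply (finite_fibers (F := h) (b := pow (type_codes E))).
    - exact _.
    - now apply finite_pow, type_codes_finite.
    - intros b Hb. apply in_pow. intros z Hz. unfold h in Hz.
      rewrite in_image in Hz. destruct Hz as (s & _ & ->).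
      apply type_code_in.
    - intros y Hy. apply NNPP. intros L. apply K. eauto. }
  destruct HK as [y HK]. set (K := sep (diff A E) (fun b => h b = y)) in *.
  assert (inK : forall b, b ∈ K -> b ∈ A /\ ~ b ∈ E /\ h b = y).
  { intros b Hb. unfold K in Hb. rewrite in_sep, in_diff in Hb. tauto. }
  assert (HKA : subset K A) by (intros b Hb; apply inK; auto).
  exists (diff A K). split; [|split].
  - destruct (amorphous_split (proj1 HA) HKA) as [L|L]; auto. destruct (HK L).
  - intros z Hz. apply in_diff in Hz. tauto.
  - intros b c s Hb Hc HbK HcK Hs HsR. rewrite in_diff in HbK, HcK.
    assert (Kb : b ∈ K) by (apply NNPP; tauto).
    assert (Kc : c ∈ K) by (apply NNPP; tauto).
    apply inK in Kb, Kc. destruct Kb as (_ & HbE & Eb), Kc as (_ & HcE & Ec).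
    assert (Hkk : ~ k ∈ k) by apply mem_irrefl.
    destruct (snoc_restrict Hs Hkk) as [Hs0 Es].
    assert (Ha : app s k ∈ A) by (eapply app_in; eauto; apply in_succ; auto).
    set (s0 := lam k (app s)) in *. set (a := app s k) in *. clearbody s0 a.
    subst s. rewrite (act_snoc Hb Hc Hs0 Ha Hkk).
    assert (L : s0 ∈ row a) by now apply in_row.
    enough (M : act k b c s0 ∈ row (transpose b c a)).
    { apply in_row in M. tauto. }
    destruct (transpose_cases b c a) as [[-> ->]|[[-> ->]|(Hab & Hac & ->)]].
    + apply (@row_transfer E); auto. unfold h in *. congruence.
    + rewrite (act_sym Hb Hc Hs0).
      apply (@row_transfer E); auto. unfold h in *. congruence.
    + apply (Hrow a Ha); auto; rewrite in_adj; intros [N|N]; auto.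
Qed.

End Rows.

Lemma finite_support A k R : strictly_amorphous A -> is_natural k ->
  exists E, finite E /\ subset E A /\ supports A k E R.
Proof.
  intros HA Hk. revert R. apply (natural_ind (P := fun k => forall R,
    exists E, finite E /\ subset E A /\ supports A k E R)); auto.
  - def.
  - intros R. exists empt. split; [apply finite_empt|]. split.
    + intros z Hz. destruct (in_empt Hz).
    + intros b c s Hb Hc _ _ Hs HsR. rewrite (act_eq Hb Hc Hs Hs); auto.
      intros i Hi. destruct (in_empt Hi).
  - intros n Hn IH R. now apply finite_support_step.
Qed.

End Supports.

(** * Formulas and satisfaction inside the model *)

Section Formulas.
Context {V : structure} {HZF : ZF V}.
Implicit Types (x y z a b c d e f g h p r s t u k m n i j X Y Z E L A R F S : V).

Fixpoint numeral (n : nat) : V :=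
  match n with O => empt | S n' => succ (numeral n') end.

Lemma is_numeral_eq (n : nat) x : is_numeral n x <-> x = numeral n.
Proof.
  revert x. induction n as [|n IH]; intros x; simpl.
  - apply is_empty_eq.
  - split.
    + intros (y & Hy & K). apply IH in Hy. subst. now apply is_succ_eq.
    + intros ->. exists (numeral n). now rewrite IH, is_succ_eq.
Qed.

Lemma numeral_natural (n : nat) : is_natural (numeral n).
Proof. induction n; simpl; auto using natural_zero, natural_succ. Qed.

Lemma numeral_inj (n n' : nat) : numeral n = numeral n' -> n = n'.
Proof.
  revert n'. induction n as [|n IH]; intros [|n']; simpl; intros H; auto.
  - symmetry in H. destruct (succ_not_empty H).
  - destruct (succ_not_empty H).
  - apply succ_inj in H. f_equal; auto.
Qed.

Definition eq_code i j : V := pair (numeral 0) (pair i j).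
Definition not_code f : V := pair (numeral 1) f.
Definition and_code f g : V := pair (numeral 2) (pair f g).
Definition ex_code f : V := pair (numeral 3) f.

#[global] Instance definable_eq_code : Definable_term2 eq_code.
Proof. unfold eq_code. def. Qed.
#[global] Instance definable_not_code : Definable_term1 not_code.
Proof. unfold not_code. def. Qed.
#[global] Instance definable_and_code : Definable_term2 and_code.
Proof. unfold and_code. def. Qed.
#[global] Instance definable_ex_code : Definable_term1 ex_code.
Proof. unfold ex_code. def. Qed.

Lemma is_tagged_eq (n : nat) c x : is_tagged n c x <-> c = pair (numeral n) x.
Proof.
  split.
  - intros (t & Ht & K). apply is_numeral_eq in Ht. subst. now apply is_pair_eq.
  - intros ->. exists (numeral n). now rewrite is_numeral_eq, is_pair_eq.
Qed.

Lemma is_eq_code_eq c i j : is_eq_code c i j <-> c = eq_code i j.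
Proof.
  split.
  - intros (p & Hp & K). apply is_pair_eq in Hp. subst. now apply is_tagged_eq.
  - intros ->. exists (pair i j). now rewrite is_pair_eq, is_tagged_eq.
Qed.

Lemma is_not_code_eq c f : is_not_code c f <-> c = not_code f.
Proof. apply is_tagged_eq. Qed.

Lemma is_and_code_eq c f g : is_and_code c f g <-> c = and_code f g.
Proof.
  split.
  - intros (p & Hp & K). apply is_pair_eq in Hp. subst. now apply is_tagged_eq.
  - intros ->. exists (pair f g). now rewrite is_pair_eq, is_tagged_eq.
Qed.

Lemma is_ex_code_eq c f : is_ex_code c f <-> c = ex_code f.
Proof. apply is_tagged_eq. Qed.

(** Solves or simplifies equations between codes by unique readability. *)
Ltac read_codes := unfold eq_code, not_code, and_code, ex_code in *;
  repeat match goal with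
  | H : pair _ _ = pair _ _ |- _ => apply pair_inj in H; destruct H
  | H : numeral _ = numeral _ |- _ => apply numeral_inj in H; discriminate H || clear H
  end.

Definition closed_under_formation F : Prop :=
  (forall m i j, is_natural m -> i ∈ m -> j ∈ m -> pair m (eq_code i j) ∈ F) /\
  (forall m f, is_natural m -> pair m f ∈ F -> pair m (not_code f) ∈ F) /\
  (forall m f g, is_natural m -> pair m f ∈ F -> pair m g ∈ F ->
     pair m (and_code f g) ∈ F) /\
  (forall m f, is_natural m -> pair (succ m) f ∈ F -> pair m (ex_code f) ∈ F).

Lemma formula_closed_iff F : formula_closed F <-> closed_under_formation F.
Proof.
  split.
  - intros [H1 H2 H3 H4]. split; [|split; [|split]].
    + intros m i j Hm Hi Hj. apply related_pair. apply (H1 m i j); auto.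
      now apply is_eq_code_eq.
    + intros m f Hm Hf. apply related_pair. apply (H2 m f); auto.
      * now apply related_pair.
      * now apply is_not_code_eq.
    + intros m f g Hm Hf Hg. apply related_pair. apply (H3 m f g); auto.
      * now apply related_pair.
      * now apply related_pair.
      * now apply is_and_code_eq.
    + intros m f Hm Hf. apply related_pair. apply (H4 m (succ m) f); auto.
      * now apply is_succ_eq.
      * now apply related_pair.
      * now apply is_ex_code_eq.
  - intros (H1 & H2 & H3 & H4). split.
    + intros m i j c Hm Hi Hj Hc. apply is_eq_code_eq in Hc. subst.
      apply related_pair; auto.
    + intros m f c Hm Hf Hc. apply is_not_code_eq in Hc. subst.
      rewrite related_pair in *. auto.
    + intros m f g c Hm Hf Hg Hc. apply is_and_code_eq in Hc. subst.
      rewrite related_pair in *. auto.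
    + intros m m' f c Hm Hm' Hf Hc. apply is_ex_code_eq in Hc.
      apply is_succ_eq in Hm'. subst. rewrite related_pair in *. auto.
Qed.

#[global] Instance definable_formula_closed : Definable1 (@formula_closed V).
Proof.
  apply definable_ext with (fun env => closed_under_formation (env 0)).
  - intros env. apply formula_closed_iff.
  - unfold closed_under_formation. def.
Qed.

#[global] Instance definable_is_formula : Definable2 (@is_formula V).
Proof. unfold is_formula. def. Qed.

Lemma is_formula_pair m c :
  is_formula m c <-> forall F, closed_under_formation F -> pair m c ∈ F.
Proof.
  split; intros H F HF.
  - apply related_pair, H. now apply formula_closed_iff.
  - apply related_pair, H. now apply formula_closed_iff.
Qed.

Lemma formula_eq m i j :
  is_natural m -> i ∈ m -> j ∈ m -> is_formula m (eq_code i j).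
Proof.
  intros Hm Hi Hj. apply is_formula_pair. intros F HF.
  destruct HF as (H1 & _). auto.
Qed.

Lemma formula_not m f : is_natural m -> is_formula m f -> is_formula m (not_code f).
Proof.
  rewrite !is_formula_pair. intros Hm Hf F HF. assert (K := HF). destruct K as (_ & H & _). auto.
Qed.

Lemma formula_and m f g : is_natural m -> is_formula m f -> is_formula m g ->
  is_formula m (and_code f g).
Proof.
  rewrite !is_formula_pair. intros Hm Hf Hg F HF. assert (K := HF). destruct K as (_ & _ & H & _). auto.
Qed.

Lemma formula_ex m f :
  is_natural m -> is_formula (succ m) f -> is_formula m (ex_code f).
Proof.
  rewrite !is_formula_pair. intros Hm Hf F HF. assert (K := HF). destruct K as (_ & _ & _ & H). auto.
Qed.

Definition add_pairs X : V := cup X (prod X X).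

#[local] Instance definable_add_pairs : Definable_term1 add_pairs.
Proof. unfold add_pairs. def. Qed.

(** A set containing the naturals and closed under pairing, hence containing every
    code.  Without such a bound no set would be closed under formation, and
    everything would count as a formula. *)
Definition codes : V := union (image (fun n => rec add_pairs omega n) omega).

Lemma in_codes x :
  x ∈ codes <-> exists n, is_natural n /\ x ∈ rec add_pairs omega n.
Proof.
  unfold codes. rewrite in_union. split.
  - intros (y & Hy & Hx). rewrite in_image in Hy. destruct Hy as (n & Hn & ->).
    exists n. now rewrite <- in_omega.
  - intros (n & Hn & Hx). exists (rec add_pairs omega n). rewrite in_image.
    split; auto. exists n. now rewrite in_omega.
Qed.

Lemma natural_in_codes n : is_natural n -> n ∈ codes.
Proof.
  intros Hn. apply in_codes. exists empt. split; [apply natural_zero|].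
  now rewrite rec_zero, in_omega.
Qed.

Lemma pair_in_codes x y : x ∈ codes -> y ∈ codes -> pair x y ∈ codes.
Proof.
  rewrite !in_codes. intros (n & Hn & Hx) (m & Hm & Hy).
  assert (K : exists l, is_natural l /\ x ∈ rec add_pairs omega l /\
                                     y ∈ rec add_pairs omega l).
  { assert (HS : forall l, is_natural l ->
      subset (rec add_pairs omega l) (rec add_pairs omega (succ l))).
    { intros l Hl z Hz. rewrite rec_succ; auto; [|exact _].
      apply in_cup; auto. }
    assert (HM := fun m n => @rec_chain _ _ add_pairs omega m n _ HS).
    assert (Hcase : n ∈ succ m \/ m ∈ succ n).
    { rewrite !in_succ. destruct (natural_total Hn Hm) as [|[|]]; auto. }
    destruct Hcase as [L|L]; [exists m | exists n]; split; auto; split; auto.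
    - now apply (HM n m).
    - now apply (HM m n). }
  destruct K as (l & Hl & Kx & Ky). exists (succ l).
  split; [now apply natural_succ|]. rewrite rec_succ; auto; [|exact _].
  apply in_cup. right. now apply pair_in_prod.
Qed.

Lemma formula_ind (P : V -> V -> Prop) : Definable2 P ->
  (forall m i j, is_natural m -> i ∈ m -> j ∈ m -> P m (eq_code i j)) ->
  (forall m f, is_natural m -> is_formula m f -> P m f -> P m (not_code f)) ->
  (forall m f g, is_natural m -> is_formula m f -> is_formula m g ->
     P m f -> P m g -> P m (and_code f g)) ->
  (forall m f, is_natural m -> is_formula (succ m) f -> P (succ m) f ->
     P m (ex_code f)) ->
  forall m c, is_formula m c -> is_natural m /\ c ∈ codes /\ P m c.
Proof.
  intros HP H1 H2 H3 H4 m c Hc.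
  set (Q := fun p => exists m c, p = pair m c /\ is_formula m c /\ P m c).
  assert (HQ : Definable1 Q) by (unfold Q; def).
  assert (HF : forall m c, pair m c ∈ sep (prod omega codes) Q <->
    is_natural m /\ c ∈ codes /\ is_formula m c /\ P m c).
  { intros m' c'. rewrite in_sep, pair_in_prod, in_omega. unfold Q. split.
    - intros ([Hm' Hc'] & m0 & c0 & E & K). apply pair_inj in E.
      destruct E; subst; auto.
    - intros (Hm' & Hc' & K). split; auto. exists m', c'; auto. }
  rewrite is_formula_pair in Hc.
  assert (K : pair m c ∈ sep (prod omega codes) Q).
  { apply Hc. split; [|split; [|split]].
    - intros m' i j Hm Hi Hj. apply HF. split; [auto|split].
      + apply pair_in_codes; [|apply pair_in_codes]; apply natural_in_codes.
        * apply numeral_natural.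
        * now apply (natural_mem Hm).
        * now apply (natural_mem Hm).
      + auto using formula_eq.
    - intros m' f Hm Hf. apply HF in Hf. destruct Hf as (_ & Hf & Hf' & Hf'').
      apply HF. split; [auto|split].
      + unfold not_code. auto using pair_in_codes, natural_in_codes,
          numeral_natural.
      + auto using formula_not.
    - intros m' f g Hm Hf Hg. apply HF in Hf, Hg.
      destruct Hf as (_ & Hf & Hf' & Hf''), Hg as (_ & Hg & Hg' & Hg'').
      apply HF. split; [auto|split].
      + unfold and_code. auto using pair_in_codes, natural_in_codes,
          numeral_natural.
      + auto using formula_and.
    - intros m' f Hm Hf. apply HF in Hf. destruct Hf as (_ & Hf & Hf' & Hf'').
      apply HF. split; [auto|split].
      + unfold ex_code. auto using pair_in_codes, natural_in_codes,
          numeral_natural.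
      + auto using formula_ex. }
  apply HF in K. tauto.
Qed.

Lemma formula_natural m c : is_formula m c -> is_natural m /\ c ∈ codes.
Proof.
  intros H. destruct (@formula_ind (fun m c => m = m)) with (m := m) (c := c); auto.
  - def.
  - tauto.
Qed.

(** ** Satisfaction *)

Definition satisfaction_clauses A S : Prop :=
  (forall m s i j, is_natural m -> is_function s m A -> i ∈ m -> j ∈ m ->
     (pair (eq_code i j) s ∈ S <-> app s i = app s j)) /\
  (forall m s f, is_natural m -> is_function s m A -> is_formula m f ->
     (pair (not_code f) s ∈ S <-> ~ pair f s ∈ S)) /\
  (forall m s f g, is_natural m -> is_function s m A -> is_formula m f ->
     is_formula m g ->
     (pair (and_code f g) s ∈ S <-> pair f s ∈ S /\ pair g s ∈ S)) /\
  (forall m s f, is_natural m -> is_function s m A -> is_formula (succ m) f ->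
     (pair (ex_code f) s ∈ S <-> exists x, x ∈ A /\ pair f (snoc s m x) ∈ S)).

Lemma is_snoc_eq s' s m x :
  (forall p, p ∈ s' <-> p ∈ s \/ is_pair p m x) <-> s' = snoc s m x.
Proof.
  split.
  - intros H. apply ext. intros p. unfold snoc.
    now rewrite in_adj, H, is_pair_eq.
  - intros -> p. unfold snoc. now rewrite in_adj, is_pair_eq.
Qed.

Lemma common_value A m s i j : is_function s m A -> i ∈ m -> j ∈ m ->
  (exists x, related s i x /\ related s j x) <-> app s i = app s j.
Proof.
  intros Hs Hi Hj. split.
  - intros (x & Hx & Hy). rewrite (function_related x Hs Hi) in Hx.
    rewrite (function_related x Hs Hj) in Hy. congruence.
  - intros E. exists (app s i).
    rewrite (function_related _ Hs Hi), (function_related _ Hs Hj). auto.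
Qed.

Lemma one_more_value A S s m f :
  (exists x s', x ∈ A /\ (forall p, p ∈ s' <-> p ∈ s \/ is_pair p m x) /\
     related S f s') <->
  exists x, x ∈ A /\ pair f (snoc s m x) ∈ S.
Proof.
  split.
  - intros (x & s' & Hx & Hs' & H). apply is_snoc_eq in Hs'. subst.
    rewrite related_pair in H. eauto.
  - intros (x & Hx & H). exists x, (snoc s m x).
    rewrite is_snoc_eq, related_pair. auto.
Qed.

Lemma is_satisfaction_iff A S : is_satisfaction A S <-> satisfaction_clauses A S.
Proof.
  split.
  - intros [H1 H2 H3 H4]. split; [|split; [|split]].
    + intros m s i j Hm Hs Hi Hj. rewrite <- related_pair.
      rewrite (H1 m s i j) by (auto; now apply is_eq_code_eq).
      eapply common_value; eauto.
    + intros m s f Hm Hs Hf. rewrite <- !related_pair.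
      apply (H2 m s f); auto. now apply is_not_code_eq.
    + intros m s f g Hm Hs Hf Hg. rewrite <- !related_pair.
      apply (H3 m s f g); auto. now apply is_and_code_eq.
    + intros m s f Hm Hs Hf. rewrite <- one_more_value, <- related_pair.
      apply (H4 m (succ m) s f); auto.
      * now apply is_succ_eq.
      * now apply is_ex_code_eq.
  - intros (H1 & H2 & H3 & H4). split.
    + intros m s i j c Hm Hs Hi Hj Hc. apply is_eq_code_eq in Hc. subst.
      rewrite (common_value Hs Hi Hj), related_pair. now apply (H1 m).
    + intros m s f c Hm Hs Hf Hc. apply is_not_code_eq in Hc. subst.
      rewrite !related_pair. now apply (H2 m).
    + intros m s f g c Hm Hs Hf Hg Hc. apply is_and_code_eq in Hc. subst.
      rewrite !related_pair. now apply (H3 m).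
    + intros m m' s f c Hm Hs Hm' Hf Hc. apply is_ex_code_eq in Hc.
      apply is_succ_eq in Hm'. subst. rewrite one_more_value, related_pair.
      now apply (H4 m).
Qed.

#[global] Instance definable_is_satisfaction : Definable2 (@is_satisfaction V).
Proof.
  apply definable_ext with (fun env => satisfaction_clauses (env 0) (env 1)).
  - intros env. apply is_satisfaction_iff.
  - unfold satisfaction_clauses. def.
Qed.

Section Valuation.
Context (A : V).

(** The clauses for the set [X] of [m]-tuples satisfying [c]; the relation [r]
    supplies the corresponding sets for the immediate subformulas. *)
Definition value_step (r : V -> V -> V -> Prop) m c X : Prop :=
  (exists i j, i ∈ m /\ j ∈ m /\ c = eq_code i j /\
     X = sep (funs m A) (fun s => app s i = app s j)) \/
  (exists f Y, c = not_code f /\ r m f Y /\ X = diff (funs m A) Y) \/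
  (exists f g Y Z, c = and_code f g /\ r m f Y /\ r m g Z /\ X = cap Y Z) \/
  (exists f Y, c = ex_code f /\ r (succ m) f Y /\
     X = sep (funs m A) (fun s => exists x, x ∈ A /\ snoc s m x ∈ Y)).

Definition triple m c X : V := pair m (pair c X).

(** The value of a formula is witnessed by a set of steps, rather than defined by
    recursion along formulas. *)
Definition justified g : Prop :=
  forall m c X, triple m c X ∈ g -> value_step (fun m c X => triple m c X ∈ g) m c X.

Definition value m c X : Prop := exists g, triple m c X ∈ g /\ justified g.

#[local] Instance definable_triple : Definable_term3 triple.
Proof. unfold triple. def. Qed.

#[local] Instance definable_value : Definable3 value.
Proof. unfold value, justified, value_step. def. Qed.

Lemma value_step_mono (r r' : V -> V -> V -> Prop) m c X :
  (forall m c X, r m c X -> r' m c X) -> value_step r m c X -> value_step r' m c X.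
Proof.
  intros H [K|[K|[K|K]]]; [left; auto | right; left | right; right; left
    | right; right; right].
  - destruct K as (f & Y & K1 & K2 & K3). exists f, Y; auto.
  - destruct K as (f & g & Y & Z & K1 & K2 & K3 & K4). exists f, g, Y, Z; auto 6.
  - destruct K as (f & Y & K1 & K2 & K3). exists f, Y; auto.
Qed.

Lemma justified_cup g h : justified g -> justified h -> justified (cup g h).
Proof.
  intros Hg Hh m c X K. apply in_cup in K.
  destruct K as [K|K]; [apply Hg in K | apply Hh in K]; revert K;
    apply value_step_mono; intros; apply in_cup; auto.
Qed.

Lemma justified_step g m c X : justified g ->
  value_step (fun m c X => triple m c X ∈ g) m c X -> value m c X.
Proof.
  intros Hg H. exists (adj g (triple m c X)). split.
  - apply in_adj; auto.
  - intros m' c' X' K. apply in_adj in K.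
    apply (value_step_mono (r := fun m c X => triple m c X ∈ g)).
    { intros; apply in_adj; auto. }
    destruct K as [K|K].
    + now apply Hg.
    + unfold triple in K. rewrite !pair_inj in K. destruct K as (-> & -> & ->).
      auto.
Qed.

Lemma value_unfold m c X : value m c X <-> value_step value m c X.
Proof.
  split.
  - intros (g & K & Hg). apply Hg in K. revert K. apply value_step_mono.
    intros m' c' X' K. exists g. auto.
  - intros [K|[K|[K|K]]].
    + apply (@justified_step empt).
      * intros m' c' X' H. destruct (in_empt H).
      * left; auto.
    + destruct K as (f & Y & E & (g & Hg & Jg) & K).
      apply (justified_step Jg). right; left. exists f, Y; auto.
    + destruct K as (f & f' & Y & Z & E & (g & Hg & Jg) & (h & Hh & Jh) & K).
      apply (justified_step (justified_cup Jg Jh)). right; right; left.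
      exists f, f', Y, Z. rewrite !in_cup. auto 6.
    + destruct K as (f & Y & E & (g & Hg & Jg) & K).
      apply (justified_step Jg). right; right; right. exists f, Y; auto.
Qed.

Lemma value_eq m i j X : i ∈ m -> j ∈ m ->
  value m (eq_code i j) X <-> X = sep (funs m A) (fun s => app s i = app s j).
Proof.
  intros Hi Hj. rewrite value_unfold. split.
  - intros [K|[K|[K|K]]].
    + destruct K as (i' & j' & _ & _ & E & ->). read_codes. now subst.
    + destruct K as (f & Y & E & _). read_codes.
    + destruct K as (f & g & Y & Z & E & _). read_codes.
    + destruct K as (f & Y & E & _). read_codes.
  - intros ->. left. exists i, j. auto.
Qed.

Lemma value_not m f X : value m (not_code f) X <->
  exists Y, value m f Y /\ X = diff (funs m A) Y.
Proof.
  rewrite value_unfold. split.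
  - intros [K|[K|[K|K]]].
    + destruct K as (i & j & _ & _ & E & _). read_codes.
    + destruct K as (f' & Y & E & HY & ->). read_codes. subst. eauto.
    + destruct K as (f' & g & Y & Z & E & _). read_codes.
    + destruct K as (f' & Y & E & _). read_codes.
  - intros (Y & HY & ->). right; left. exists f, Y. auto.
Qed.

Lemma value_and m f g X : value m (and_code f g) X <->
  exists Y Z, value m f Y /\ value m g Z /\ X = cap Y Z.
Proof.
  rewrite value_unfold. split.
  - intros [K|[K|[K|K]]].
    + destruct K as (i & j & _ & _ & E & _). read_codes.
    + destruct K as (f' & Y & E & _). read_codes.
    + destruct K as (f' & g' & Y & Z & E & HY & HZ & ->). read_codes. subst. eauto.
    + destruct K as (f' & Y & E & _). read_codes.
  - intros (Y & Z & HY & HZ & ->). right; right; left. exists f, g, Y, Z. auto.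
Qed.

Lemma value_ex m f X : value m (ex_code f) X <->
  exists Y, value (succ m) f Y /\
    X = sep (funs m A) (fun s => exists x, x ∈ A /\ snoc s m x ∈ Y).
Proof.
  rewrite value_unfold. split.
  - intros [K|[K|[K|K]]].
    + destruct K as (i & j & _ & _ & E & _). read_codes.
    + destruct K as (f' & Y & E & _). read_codes.
    + destruct K as (f' & g & Y & Z & E & _). read_codes.
    + destruct K as (f' & Y & E & HY & ->). read_codes. subst. eauto.
  - intros (Y & HY & ->). right; right; right. exists f, Y. auto.
Qed.

Lemma value_functional m c : is_formula m c ->
  exists X, forall Y, value m c Y <-> Y = X.
Proof.
  apply (@formula_ind (fun m c => exists X, forall Y, value m c Y <-> Y = X)).
  - def.
  - intros n i j Hn Hi Hj. eexists. intros Y. now apply value_eq.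
  - intros n f Hn Hf [X HX]. eexists. intros Y. rewrite value_not. split.
    + intros (Z & HZ & ->). apply HX in HZ. subst. reflexivity.
    + intros ->. exists X. now rewrite HX.
  - intros n f g Hn Hf Hg [X HX] [X' HX']. exists (cap X X'). intros Y.
    rewrite value_and. split.
    + intros (Z & Z' & HZ & HZ' & ->). apply HX in HZ. apply HX' in HZ'.
      now subst.
    + intros ->. exists X, X'. now rewrite HX, HX'.
  - intros n f Hn Hf [X HX]. eexists. intros Y. rewrite value_ex. split.
    + intros (Z & HZ & ->). apply HX in HZ. subst. reflexivity.
    + intros ->. exists X. now rewrite HX.
Qed.

Definition satisfaction : V :=
  sep (prod codes (pow (prod omega A))) (fun p => exists c s m X,
    p = pair c s /\ is_function s m A /\ is_formula m c /\ value m c X /\ s ∈ X).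

Lemma in_satisfaction m c s X : is_formula m c -> is_function s m A ->
  value m c X -> pair c s ∈ satisfaction <-> s ∈ X.
Proof.
  intros Hc Hs HX. unfold satisfaction. rewrite in_sep. split.
  - intros (_ & c' & s' & m' & X' & E & Hs' & Hc' & HX' & K).
    apply pair_inj in E. destruct E; subst c' s'.
    assert (m' = m) by exact (function_domain_unique Hs' Hs). subst m'.
    destruct (value_functional Hc) as [Y HY]. apply HY in HX, HX'. congruence.
  - intros K. split; [|exists c, s, m, X; auto].
    destruct (formula_natural Hc) as [Hm Hcc].
    apply pair_in_prod. split; auto. apply in_pow. intros p Hp.
    rewrite (function_mem _ Hs) in Hp. destruct Hp as (i & Hi & ->).
    apply pair_in_prod. split.
    + apply in_omega. now apply (natural_mem Hm).
    + eapply app_in; eauto.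
Qed.

Lemma satisfaction_exists : is_satisfaction A satisfaction.
Proof.
  apply is_satisfaction_iff. split; [|split; [|split]].
  - intros m s i j Hm Hs Hi Hj.
    rewrite (in_satisfaction (formula_eq Hm Hi Hj) Hs
               (proj2 (value_eq _ Hi Hj) eq_refl)).
    rewrite in_sep, in_funs. tauto.
  - intros m s f Hm Hs Hf. destruct (value_functional Hf) as [X HX].
    assert (K := proj2 (HX X) eq_refl).
    rewrite (in_satisfaction Hf Hs K).
    rewrite (in_satisfaction (X := diff (funs m A) X) (formula_not Hm Hf) Hs).
    + rewrite in_diff, in_funs. tauto.
    + apply value_not. eauto.
  - intros m s f g Hm Hs Hf Hg.
    destruct (value_functional Hf) as [X HX], (value_functional Hg) as [Y HY].
    assert (K := proj2 (HX X) eq_refl). assert (L := proj2 (HY Y) eq_refl).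
    rewrite (in_satisfaction Hf Hs K), (in_satisfaction Hg Hs L).
    rewrite (in_satisfaction (X := cap X Y) (formula_and Hm Hf Hg) Hs).
    + apply in_cap.
    + apply value_and. eauto.
  - intros m s f Hm Hs Hf. destruct (value_functional Hf) as [X HX].
    assert (K := proj2 (HX X) eq_refl).
    rewrite (in_satisfaction (X := sep (funs m A)
      (fun s => exists x, x ∈ A /\ snoc s m x ∈ X)) (formula_ex Hm Hf) Hs).
    + rewrite in_sep, in_funs.
      assert (L : forall x, x ∈ A ->
        (pair f (snoc s m x) ∈ satisfaction <-> snoc s m x ∈ X)).
      { intros x Hx. apply (in_satisfaction Hf); auto.
        apply (snoc_function Hs Hx). apply mem_irrefl. }
      split.
      * intros (_ & x & Hx & M). exists x. now rewrite L.
      * intros (x & Hx & M). rewrite L in M by auto. eauto.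
    + apply value_ex. eauto.
Qed.

End Valuation.
End Formulas.

(** * Finite support is the same as definability *)

Section Definability_of_supported.
Context {V : structure} {HZF : ZF V}.
Implicit Types (x y z a b c d e f g h p q r s t u k m n i j X Y Z E L A R F S : V).

(** Only the trace of [X] on the [m]-tuples matters. *)
Definition expressible A m X : Prop :=
  exists f, is_formula m f /\
    forall S s, is_satisfaction A S -> is_function s m A ->
      (pair f s ∈ S <-> s ∈ X).

#[local] Instance definable_expressible : Definable3 expressible.
Proof. unfold expressible. def. Qed.

Lemma expressible_ext A m X Y :
  (forall s, is_function s m A -> (s ∈ X <-> s ∈ Y)) ->
  expressible A m X -> expressible A m Y.
Proof.
  intros H (f & Hf & K). exists f. split; auto. intros S s HS Hs.
  rewrite <- H by auto. auto.
Qed.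

Lemma expressible_eq A m i j : is_natural m -> i ∈ m -> j ∈ m ->
  expressible A m (sep (funs m A) (fun s => app s i = app s j)).
Proof.
  intros Hm Hi Hj. exists (eq_code i j). split; [now apply formula_eq|].
  intros S s HS Hs. apply is_satisfaction_iff in HS. destruct HS as (H & _).
  rewrite (H m s i j) by auto. rewrite in_sep, in_funs. tauto.
Qed.

Lemma expressible_compl A m X : is_natural m ->
  expressible A m X -> expressible A m (diff (funs m A) X).
Proof.
  intros Hm (f & Hf & K). exists (not_code f). split; [now apply formula_not|].
  intros S s HS Hs. assert (HS' := HS). apply is_satisfaction_iff in HS.
  destruct HS as (_ & H & _).
  rewrite (H m s f), (K S s) by auto. rewrite in_diff, in_funs. tauto.
Qed.

Lemma expressible_cap A m X Y : is_natural m ->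
  expressible A m X -> expressible A m Y -> expressible A m (cap X Y).
Proof.
  intros Hm (f & Hf & K) (g & Hg & L). exists (and_code f g).
  split; [now apply formula_and|].
  intros S s HS Hs. assert (HS' := HS). apply is_satisfaction_iff in HS.
  destruct HS as (_ & _ & H & _).
  rewrite (H m s f g), (K S s), (L S s) by auto. now rewrite in_cap.
Qed.

Lemma expressible_cup A m X Y : is_natural m ->
  expressible A m X -> expressible A m Y -> expressible A m (cup X Y).
Proof.
  intros Hm HX HY.
  apply expressible_ext with
    (diff (funs m A) (cap (diff (funs m A) X) (diff (funs m A) Y))).
  - intros s Hs. rewrite in_cup, in_diff, in_cap, !in_diff, in_funs.
    destruct (classic (s ∈ X)), (classic (s ∈ Y)); tauto.
  - auto using expressible_compl, expressible_cap.
Qed.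

(** With at least one variable at hand, [x_i = x_i] is a tautology. *)
Lemma expressible_full A m : is_natural m -> m <> empt ->
  expressible A m (funs m A).
Proof.
  intros Hm H0. destruct (nonempty_inhabited H0) as [i Hi].
  apply expressible_ext with (sep (funs m A) (fun s => app s i = app s i)).
  - intros s Hs. rewrite in_sep. tauto.
  - now apply expressible_eq.
Qed.

Lemma expressible_union A m Y : is_natural m -> m <> empt -> finite Y ->
  (forall X, X ∈ Y -> expressible A m X) -> expressible A m (union Y).
Proof.
  intros Hm H0. apply (finite_ind (P := fun Y =>
    (forall X, X ∈ Y -> expressible A m X) -> expressible A m (union Y))).
  - def.
  - intros _. apply expressible_ext with (diff (funs m A) (funs m A)).
    + intros s Hs. rewrite in_diff, in_union. split; [tauto|].
      intros (y & Hy & _). destruct (in_empt Hy).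
    + auto using expressible_compl, expressible_full.
  - intros W X HW _ IH H. apply expressible_ext with (cup (union W) X).
    + intros s _. rewrite in_cup, !in_union. split.
      * intros [(y & Hy & K)|K]; [exists y | exists X]; rewrite in_adj; auto.
      * intros (y & Hy & K). apply in_adj in Hy. destruct Hy as [Hy| ->]; eauto.
    + apply expressible_cup; auto.
      * apply IH. intros y Hy. apply H, in_adj; auto.
      * apply H, in_adj; auto.
Qed.

Lemma expressible_inter A m Y : is_natural m -> m <> empt -> finite Y ->
  (forall X, X ∈ Y -> expressible A m X) ->
  expressible A m (sep (funs m A) (fun s => forall X, X ∈ Y -> s ∈ X)).
Proof.
  intros Hm H0. apply (finite_ind (P := fun Y =>
    (forall X, X ∈ Y -> expressible A m X) ->
    expressible A m (sep (funs m A) (fun s => forall X, X ∈ Y -> s ∈ X)))).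
  - def.
  - intros _. apply expressible_ext with (funs m A).
    + intros s Hs. rewrite in_sep. split; [|tauto]. intros K. split; auto.
      intros X HX. destruct (in_empt HX).
    + auto using expressible_full.
  - intros W X HW _ IH H.
    apply expressible_ext with
      (cap (sep (funs m A) (fun s => forall X, X ∈ W -> s ∈ X)) X).
    + intros s _. rewrite in_cap, !in_sep. split.
      * intros [[K L] M]. split; auto. intros y Hy. apply in_adj in Hy.
        destruct Hy as [Hy| ->]; auto.
      * intros [K L]. split; [split|]; auto.
        -- intros y Hy. apply L, in_adj; auto.
        -- apply L, in_adj; auto.
    + apply expressible_cap; auto.
      * apply IH. intros y Hy. apply H, in_adj; auto.
      * apply H, in_adj; auto.
Qed.

Definition pattern_class A m q : V := sep (funs m A) (fun t => equalities m t = q).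

#[local] Instance definable_pattern_class : Definable_term3 pattern_class.
Proof. unfold pattern_class. def. Qed.

Lemma expressible_pattern A m s : is_natural m -> m <> empt ->
  is_function s m A -> expressible A m (pattern_class A m (equalities m s)).
Proof.
  intros Hm H0 Hs.
  set (lit := fun p => sep (funs m A)
    (fun t => p ∈ equalities m t <-> p ∈ equalities m s)).
  assert (Hlit : Definable_term1 lit) by (unfold lit; def).
  assert (Hl : forall p, p ∈ prod m m -> expressible A m (lit p)).
  { intros p Hp. apply in_prod in Hp. destruct Hp as (i & j & Hi & Hj & ->).
    destruct (classic (app s i = app s j)) as [K|K].
    - eapply expressible_ext; [|apply (expressible_eq A Hm Hi Hj)].
      intros t Ht. unfold lit. rewrite !in_sep, !pair_in_equalities. tauto.
    - eapply expressible_ext;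
        [|apply (expressible_compl Hm (expressible_eq A Hm Hi Hj))].
      intros t Ht. unfold lit.
      rewrite in_diff, !in_sep, in_funs, !pair_in_equalities. tauto. }
  eapply expressible_ext;
    [|apply (@expressible_inter A m (image lit (prod m m)) Hm H0)].
  - intros t Ht. unfold pattern_class. rewrite !in_sep, in_funs. split.
    + intros [_ K]. split; auto.
      assert (L : forall p, p ∈ prod m m ->
                    (p ∈ equalities m t <-> p ∈ equalities m s)).
      { intros p Hp. assert (M : t ∈ lit p).
        { apply K. rewrite in_image. eauto. }
        unfold lit in M. rewrite in_sep in M. tauto. }
      apply ext. intros p. split; intros Hp; apply L in Hp; auto;
        eapply equalities_bounded; eauto.
    + intros [_ K]. split; auto. intros X HX. rewrite in_image in HX.
      destruct HX as (p & _ & ->). unfold lit. rewrite in_sep, in_funs, K. tauto.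
  - apply finite_image; auto. apply finite_prod; now apply finite_natural.
  - intros X HX. rewrite in_image in HX. destruct HX as (p & Hp & ->). auto.
Qed.

(** A set of tuples invariant under equality of patterns is the union of its pattern
    classes, and patterns are subsets of the finite set [prod m m]. *)
Lemma expressible_invariant A m X : is_natural m -> m <> empt ->
  (forall s t, is_function s m A -> is_function t m A ->
     equalities m s = equalities m t -> s ∈ X -> t ∈ X) ->
  expressible A m X.
Proof.
  intros Hm H0 H.
  set (Q := image (fun s => equalities m s) (cap X (funs m A))).
  apply expressible_ext with (union (image (fun q => pattern_class A m q) Q)).
  - intros t Ht. rewrite in_union. split.
    + intros (y & Hy & K). rewrite in_image in Hy. destruct Hy as (q & Hq & ->).
      unfold Q in Hq. rewrite in_image in Hq. destruct Hq as (s & Hs & ->).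
      rewrite in_cap, in_funs in Hs. unfold pattern_class in K.
      rewrite in_sep in K. apply (H s t); try tauto. symmetry; tauto.
    + intros K. exists (pattern_class A m (equalities m t)). split.
      * rewrite in_image. exists (equalities m t). split; auto.
        unfold Q. rewrite in_image. exists t. rewrite in_cap, in_funs. auto.
      * unfold pattern_class. rewrite in_sep, in_funs. auto.
  - apply expressible_union; auto.
    + apply finite_image; [def|].
      assert (Fm := finite_natural Hm).
      apply (finite_subset (finite_pow (finite_prod Fm Fm))).
      intros q Hq. unfold Q in Hq. rewrite in_image in Hq.
      destruct Hq as (s & _ & ->). apply in_pow, equalities_bounded.
    + intros y Hy. rewrite in_image in Hy. destruct Hy as (q & Hq & ->).
      unfold Q in Hq. rewrite in_image in Hq. destruct Hq as (s & Hs & ->).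
      rewrite in_cap, in_funs in Hs. now apply expressible_pattern.
Qed.

(** The elements of [E] will be the parameters, at the indices from [k] on. *)
Lemma parameters_exist A k E : is_natural k -> finite E -> subset E A ->
  exists m e, is_natural m /\ subset k m /\ is_function e (diff m k) A /\
    forall x, x ∈ E -> exists i, i ∈ diff m k /\ app e i = x.
Proof.
  intros Hk. apply (finite_ind (P := fun E => subset E A ->
  exists m e, is_natural m /\ subset k m /\ is_function e (diff m k) A /\
    forall x, x ∈ E -> exists i, i ∈ diff m k /\ app e i = x)).
  - def.
  - intros _. exists k, empt. split; auto. split; [intros z Hz; auto|].
    replace (diff k k) with (@empt V HZF).
    + split; [apply function_empty|]. intros x Hx. destruct (in_empt Hx).
    + symmetry. apply is_empty_eq. intros z. rewrite in_diff. tauto.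
  - intros F x HF _ IH HA. destruct IH as (m & e & Hm & Hkm & He & Hs).
    { intros y Hy. apply HA, in_adj; auto. }
    assert (Hx : x ∈ A) by (apply HA, in_adj; auto).
    assert (Hmd : ~ m ∈ diff m k).
    { rewrite in_diff. intros [K _]. apply (mem_irrefl K). }
    destruct (snoc_function He Hx Hmd) as (H1 & H2 & H3).
    assert (E1 : adj (diff m k) m = diff (succ m) k).
    { apply ext. intros z. rewrite in_adj, !in_diff, in_succ. split.
      - intros [K|K]; [tauto|]. subst z. split; auto. intros L.
        apply (mem_irrefl (Hkm m L)).
      - tauto. }
    rewrite E1 in H1. exists (succ m), (snoc e m x).
    split; [now apply natural_succ|]. split.
    { intros z Hz. apply in_succ. auto. }
    split; auto. rewrite <- E1. intros y Hy. apply in_adj in Hy.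
    destruct Hy as [Hy| ->].
    + destruct (Hs y Hy) as (i & Hi & K). exists i. rewrite in_adj.
      split; auto. now rewrite H2.
    + exists m. rewrite in_adj. auto.
Qed.

Lemma cup_diff k m : subset k m -> cup k (diff m k) = m.
Proof.
  intros H. apply ext. intros z. rewrite in_cup, in_diff.
  destruct (classic (z ∈ k)); split; auto; tauto.
Qed.

Lemma tuple_with_parameters A k m a e : subset k m ->
  is_function a k A -> is_function e (diff m k) A ->
  is_function (cup a e) m A /\
  (forall i, i ∈ k -> app (cup a e) i = app a i) /\
  (forall i, i ∈ diff m k -> app (cup a e) i = app e i).
Proof.
  intros Hkm Ha He. rewrite <- (cup_diff Hkm) at 1.
  apply (function_cup Ha He). intros i Hi. rewrite in_diff. tauto.
Qed.

(** With the elements of [E] appended to a tuple as further entries, its type over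
    [E] becomes a pattern of equalities between entries. *)
Lemma supports_definable A k E R : is_natural k -> k <> empt ->
  finite E -> subset E A -> supports A k E R -> definable_with_parameters A k R.
Proof.
  intros Hk H0 HE HEA HR.
  destruct (parameters_exist Hk HE HEA) as (m & e & Hm & Hkm & He & Hs).
  assert (Hm0 : m <> empt).
  { intros ->. apply H0, is_empty_eq. intros z Hz. apply (in_empt (Hkm z Hz)). }
  set (X := sep (funs m A) (fun t => exists a, is_function a k A /\ a ∈ R /\
    equalities m (cup a e) = equalities m t)).
  destruct (@expressible_invariant A m X Hm Hm0) as (f & Hf & K).
  { intros s t Hs' Ht Est Hx. unfold X in *. rewrite in_sep, in_funs in *.
    destruct Hx as (_ & a & Ha & HaR & Ea). split; auto. exists a.
    rewrite Ea. auto. }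
  exists m, f, (diff m k), e.
  split; [auto|]. split; [auto|]. split; [auto|].
  split; [now apply is_diff_eq|]. split; [auto|].
  intros a Ha. destruct (tuple_with_parameters Hkm Ha He) as (Hae & Ha1 & Ha2).
  split.
  - intros HaR. exists (cup a e). split; [now apply is_union_eq|].
    exists (satisfaction A). split; [apply satisfaction_exists|].
    apply related_pair. apply K; auto; [apply satisfaction_exists|].
    unfold X. rewrite in_sep, in_funs. split; auto. exists a. auto.
  - intros (s & Hsu & S & HS & HfS). apply is_union_eq in Hsu. subst s.
    rewrite related_pair, K in HfS by auto. unfold X in HfS.
    rewrite in_sep in HfS. destruct HfS as (_ & a' & Ha' & HaR' & Ea).
    destruct (tuple_with_parameters Hkm Ha' He) as (Hae' & Ha1' & Ha2').
    rewrite equalities_eq in Ea.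
    apply (@supports_same_type _ _ A k E R a' a); auto. split.
    + intros i j Hi Hj. rewrite <- !Ha1, <- !Ha1' by auto. auto.
    + intros i x Hi Hx. destruct (Hs x Hx) as (j & Hj & <-).
      rewrite <- Ha1, <- Ha1' by auto. rewrite <- Ha2 at 2 by auto.
      rewrite <- Ha2' by auto. apply Ea; auto.
      apply in_diff in Hj. tauto.
Qed.

(** Induction on formulas; for negation the transposition is undone by itself, and
    for the quantifier it is applied to the witness. *)
Lemma satisfaction_invariant A S b c m f : is_satisfaction A S ->
  b ∈ A -> c ∈ A -> is_formula m f ->
  forall s, is_function s m A -> pair f s ∈ S -> pair f (act m b c s) ∈ S.
Proof.
  intros HS Hb Hc Hf. apply is_satisfaction_iff in HS.
  destruct HS as (H1 & H2 & H3 & H4).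
  apply (@formula_ind _ _ (fun m f => forall s, is_function s m A ->
    pair f s ∈ S -> pair f (act m b c s) ∈ S)); auto.
  - def.
  - intros n i j Hn Hi Hj s Hs. rewrite !(H1 n) by auto using act_function.
    rewrite !app_act by auto. now rewrite transpose_inj.
  - intros n g Hn Hg IH s Hs. rewrite !(H2 n) by auto using act_function.
    intros K L. apply K. rewrite <- (act_involutive Hb Hc Hs).
    apply IH; auto using act_function.
  - intros n g h Hn Hg Hh IH1 IH2 s Hs.
    rewrite !(H3 n) by auto using act_function. intros [K L]. auto.
  - intros n g Hn Hg IH s Hs.
    rewrite !(H4 n) by auto using act_function. intros (x & Hx & K).
    assert (Hnn : ~ n ∈ n) by apply mem_irrefl.
    exists (transpose b c x). split; [now apply transpose_in|].
    rewrite <- (act_snoc Hb Hc Hs Hx Hnn). apply IH; auto.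
    now apply snoc_function.
Qed.

Lemma definable_supported A k R : is_natural k ->
  definable_with_parameters A k R ->
  exists E, finite E /\ subset E A /\ supports A k E R.
Proof.
  intros Hk (m & f & d & e & Hm & Hkm & Hf & Hd & He & H).
  apply is_diff_eq in Hd. subst d.
  exists (image (fun i => app e i) (diff m k)). split; [|split].
  - apply finite_image; [def|]. apply (finite_subset (finite_natural Hm)).
    intros z Hz. apply in_diff in Hz. tauto.
  - intros z Hz. rewrite in_image in Hz. destruct Hz as (i & Hi & ->).
    eapply app_in; eauto.
  - intros b c s Hb Hc HbE HcE Hs HsR. rewrite in_image in HbE, HcE.
    apply H in HsR; auto. destruct HsR as (u & Hu & S & HS & HfS).
    apply is_union_eq in Hu. subst u. rewrite related_pair in HfS.
    assert (Hs' := act_function Hb Hc Hs). apply H; auto.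
    destruct (tuple_with_parameters Hkm Hs He) as (Hse & K1 & K2).
    destruct (tuple_with_parameters Hkm Hs' He) as (Hse' & L1 & L2).
    exists (cup (act k b c s) e). split; [now apply is_union_eq|].
    exists S. split; auto. rewrite related_pair.
    replace (cup (act k b c s) e) with (act m b c (cup s e)).
    + now apply satisfaction_invariant with A.
    + eapply act_eq; eauto. intros i Hi. rewrite <- (cup_diff Hkm) in Hi.
      apply in_cup in Hi. destruct Hi as [Hi|Hi].
      * now rewrite K1, L1, app_act.
      * rewrite K2, L2 by auto. apply transpose_other; intros E; [apply HbE | apply HcE];
          exists i; auto.
Qed.

End Definability_of_supported.

Section Converse.
Context {V : structure} {HZF : ZF V}.
Implicit Types (x y z a b c d e f g h p q r s t u k m n i j X Y Z E L A R F S P B C N : V).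

Definition zero : V := empt.
Definition one : V := succ empt.
Definition two : V := succ one.

Lemma one_natural : is_natural one.
Proof. apply natural_succ, natural_zero. Qed.

Lemma two_natural : is_natural two.
Proof. apply natural_succ, one_natural. Qed.

Definition tuple1 x : V := snoc empt empt x.
Definition tuple2 x y : V := snoc (tuple1 x) one y.

Lemma tuple1_function A x : x ∈ A ->
  is_function (tuple1 x) one A /\ app (tuple1 x) zero = x.
Proof.
  intros Hx.
  destruct (snoc_function (function_empty A) Hx (in_empt (z := empt)))
    as (H1 & H2 & H3).
  split; auto.
Qed.

Lemma tuple2_function A x y : x ∈ A -> y ∈ A ->
  is_function (tuple2 x y) two A /\ app (tuple2 x y) zero = x /\
  app (tuple2 x y) one = y.
Proof.
  intros Hx Hy. destruct (tuple1_function Hx) as [H1 H2].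
  destruct (snoc_function H1 Hy (@mem_irrefl _ _ one)) as (K1 & K2 & K3).
  split; [exact K1|]. split; [|exact K3].
  unfold tuple2. rewrite K2; auto. apply in_succ; auto.
Qed.

Lemma zero_in_one : zero ∈ one.
Proof. apply in_succ; auto. Qed.
Lemma zero_in_two : zero ∈ two.
Proof. apply in_succ. left. apply zero_in_one. Qed.
Lemma one_in_two : one ∈ two.
Proof. apply in_succ; auto. Qed.

Definition all_supported A : Prop := forall k R, is_natural k -> k <> empt ->
  (forall a, a ∈ R -> is_function a k A) ->
  exists E, finite E /\ subset E A /\ supports A k E R.

Lemma strongly_amorphous_iff A :
  strongly_amorphous A <-> infinite A /\ all_supported A.
Proof.
  split; intros [HA H]; split; auto; intros k R Hk H0 HR.
  - apply definable_supported; auto. apply H; auto.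
    intros K. apply H0. now apply is_empty_eq.
  - rewrite is_empty_eq in H0.
    destruct (H k R Hk H0 HR) as (E & HE & HEA & K).
    now apply (supports_definable Hk H0 HE HEA).
Qed.

(** If both halves of a splitting were infinite, a transposition outside the support
    would carry an element of one to an element of the other. *)
Lemma supported_amorphous A : infinite A -> all_supported A -> amorphous A.
Proof.
  intros HA H. split; auto. intros (B & C & HBC & Hd & HB & HC).
  apply is_union_eq in HBC.
  assert (HBA : subset B A) by (intros z Hz; rewrite HBC; apply in_cup; auto).
  assert (HCA : subset C A) by (intros z Hz; rewrite HBC; apply in_cup; auto).
  destruct (H one (sep (funs one A) (fun s => app s zero ∈ B)))
    as (E & HE & HEA & K).
  - apply one_natural.
  - apply succ_not_empty.
  - intros a Ha. rewrite in_sep, in_funs in Ha. tauto.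
  - destruct (infinite_member HB HE) as (b & Hb & HbE).
    destruct (infinite_member HC HE) as (c & Hc & HcE).
    destruct (@tuple1_function A b) as [L1 L2]; auto.
    assert (M := K b c (tuple1 b) (HBA b Hb) (HCA c Hc) HbE HcE L1).
    rewrite !in_sep, !in_funs, app_act, L2, transpose_left in M
      by apply zero_in_one.
    apply (Hd c); tauto.
Qed.

(** If [x] and [y] share a block and [y] is outside the support, transposing [y] with
    any [z] outside the support puts [z] in that block too.  So all non-singleton
    blocks but one meet the support. *)
Lemma supported_partition A P : all_supported A -> is_partition P A ->
  exists N, (forall b, b ∈ N <-> b ∈ P /\ ~ (exists x, is_singleton b x)) /\
       finite N.
Proof.
  intros H [HP1 HP2].
  assert (same_block : forall x b b', b ∈ P -> b' ∈ P -> x ∈ b -> x ∈ b' -> b = b').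
  { intros x b b' Hb Hb' Hx Hx'.
    destruct (HP2 x) as (b0 & _ & K); [apply (HP1 b); auto|].
    transitivity b0; [symmetry|]; apply K; auto. }
  destruct (H two (sep (funs two A)
    (fun s => exists b, b ∈ P /\ app s zero ∈ b /\ app s one ∈ b)))
    as (E & HE & HEA & K).
  { apply two_natural. }
  { apply succ_not_empty. }
  { intros a Ha. rewrite in_sep, in_funs in Ha. tauto. }
  exists (sep P (fun b => ~ (exists x, is_singleton b x))).
  split.
  { intros b. rewrite in_sep. tauto. }
  (* [M] consists of the blocks that meet [E]: the union below is over one block. *)
  set (M := image (fun x => union (sep P (fun b => x ∈ b))) E).
  assert (HM : finite M) by (apply finite_image; auto; def).
  assert (inM : forall b x, b ∈ P -> x ∈ b -> x ∈ E -> b ∈ M).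
  { intros b x Hb Hx HxE. unfold M. rewrite in_image. exists x. split; auto.
    apply ext. intros z. rewrite in_union. split.
    - intros Hz. exists b. rewrite in_sep. auto.
    - intros (b' & Hb' & Hz). rewrite in_sep in Hb'. destruct Hb' as [Hb' Hx'].
      now rewrite (same_block x b b'). }
  assert (only : forall b b' x y z, b ∈ P -> b' ∈ P -> x ∈ b -> y ∈ b -> x <> y ->
    ~ y ∈ E -> z ∈ b' -> ~ z ∈ E -> b = b').
  { intros b b' x y z Hb Hb' Hx Hy Hxy HyE Hz HzE.
    assert (x ∈ A) as HxA by (apply (HP1 b); auto).
    assert (y ∈ A) as HyA by (apply (HP1 b); auto).
    assert (z ∈ A) as HzA by (apply (HP1 b'); auto).
    destruct (classic (x = z)) as [->|Hxz]; [eauto|].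
    destruct (@tuple2_function A x y) as (L1 & L2 & L3); auto.
    assert (N := K y z (tuple2 x y) HyA HzA HyE HzE L1).
    rewrite !in_sep, !in_funs, !app_act, L2, L3, transpose_left,
      transpose_other in N by (auto using zero_in_two, one_in_two).
    destruct N as (_ & b0 & Hb0 & Hx0 & Hz0); [split; eauto|].
    transitivity b0; eauto. }
  assert (other : forall b, b ∈ P -> ~ b ∈ M -> ~ (exists x, is_singleton b x) ->
    exists x y, x ∈ b /\ y ∈ b /\ x <> y /\ ~ y ∈ E).
  { intros b Hb HbM Hs. destruct (HP1 b Hb) as [Hne _].
    destruct (@nonempty_inhabited _ _ b) as [y Hy].
    { intros L. apply Hne. now apply is_empty_eq. }
    assert (HyE : ~ y ∈ E) by eauto.
    apply NNPP. intros L. apply Hs. exists y. apply is_singleton_eq, ext.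
    intros z. rewrite in_sing. split; [|now intros ->].
    intros Hz. apply NNPP. intros Hzy. apply L. exists z, y. auto. }
  destruct (classic (exists b x y, b ∈ P /\ x ∈ b /\ y ∈ b /\ x <> y /\ ~ y ∈ E))
    as [(b & x & y & Hb & Hx & Hy & Hxy & HyE)|Hno].
  - apply (finite_subset (finite_adj b HM)). intros b' Hb'.
    rewrite in_sep in Hb'.
    destruct Hb' as [Hb' Hs]. apply in_adj.
    destruct (classic (b' ∈ M)) as [L|L]; auto. right.
    destruct (other b' Hb' L Hs) as (x' & y' & Hx' & Hy' & Hxy' & HyE').
    symmetry. eapply (only b b' x y y'); eauto.
  - apply (finite_subset HM). intros b Hb.
    rewrite in_sep in Hb.
    destruct Hb as [Hb Hs]. apply NNPP. intros L.
    destruct (other b Hb L Hs) as (x & y & Hx & Hy & Hxy & HyE).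
    apply Hno. exists b, x, y. auto.
Qed.

End Converse.

Theorem theorem4p2 (V : structure) (HZF : ZF V) (A : V) :
  strictly_amorphous A <-> strongly_amorphous A.
Proof.
  rewrite strongly_amorphous_iff. split.
  - intros HA. split; [apply HA|]. intros k R Hk _ _. now apply finite_support.
  - intros [HA H]. split; [now apply supported_amorphous|].
    intros P HP. now apply supported_partition with A.
Qed.
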